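(* Let $n\ge2$, $p>1$, $q>1$, $d=\frac{(n-1)(q-1)}{p-1}+1$, $\lambda=d(q-2)+q$, and let $C>0$. Consider the equation $$u_t=|Du|^{q-2}\big(\Delta u+(p-2)\Delta_\infty^N u\big)\quad\text{in }\mathbb{R}^n\times(0,\infty).\qquad(E)$$ (a) If $q>2$, the function $\mathcal B^{q,d,p}(x,t;C)=\mathcal B^{q,d}\big(|x|,\tfrac{p-1}{q-1}t;C\big)$, with $$\mathcal B^{q,d}(r,s;C)=s^{-d/\lambda}\Big(C-\frac{q-2}{q}\lambda^{\frac1{1-q}}\Big(\frac{r}{s^{1/\lambda}}\Big)^{\frac q{q-1}}\Big)_+^{\frac{q-1}{q-2}},$$ is a viscosity solution of $(E)$. (b) If $1<q<2$ and the range condition $$q>1\ \text{ if }p\ge\frac{1+n}2,\qquad q>\frac{2(n-p)}{n-1}\ \text{ if }1<p<\frac{1+n}2,$$ holds, the function $\mathcal B^{q,d,p}(x,t;C)=\mathcal B^{q,d}\big(|x|,\tfrac{p-1}{q-1}t;C\big)$, with $$\mathcal B^{q,d}(r,s;C)=s^{-d/\lambda}\Big(C+\frac{2-q}{q}\lambda^{\frac1{1-q}}\Big(\frac{r}{s^{1/\lambda}}\Big)^{\frac q{q-1}}\Big)^{-\frac{q-1}{2-q}},$$ is a viscosity solution of $(E)$. (c) If $q=2$, the function $U(x,t)=C\,t^{-d/2}\exp\big(-\frac{|x|^2}{4(p-1)t}\big)$ is a viscosity solution of $(E)$.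
   Context: For $\xi\in\mathbb{R}^n\setminus\{0\}$ and a symmetric $n\times n$ matrix $X$ let $F(\xi,X)=|\xi|^{q-2}\big(\operatorname{tr}X+(p-2)\frac{\langle X\xi,\xi\rangle}{|\xi|^2}\big)$; thus $|Du|^{q-2}(\Delta u+(p-2)\Delta_\infty^N u)=F(Du,D^2u)$, where $\Delta_\infty^N u=\sum_{i,j}\frac{\partial_i u}{|Du|}\frac{\partial_j u}{|Du|}\partial_{ij}u$. $(\cdot)_+=\max\{\cdot,0\}$. Let $\mathcal F$ be the set of $f\in C^2([0,\infty))$ with $f(0)=f'(0)=f''(0)=0$, $f''(r)>0$ for all $r>0$, and such that $g(x):=f(|x|)$ satisfies $\lim_{x\to0,\,x\ne0}F(Dg(x),D^2g(x))=0$. Let $\Sigma$ be the set of even $\sigma\in C^1(\mathbb{R})$ with $\sigma(0)=\sigma'(0)=0$ and $\sigma(r)>0$ for $r\neq0$. Let $\Theta\subset\mathbb{R}^{n+1}$ be open. A function $\varphi\in C^2(\Theta)$ is admissible if for every $(x_0,t_0)\in\Theta$ with $D\varphi(x_0,t_0)=0$ there are $\delta>0$, $f\in\mathcal F$, $\sigma\in\Sigma$ with $|\varphi(x,t)-\varphi(x_0,t_0)-\varphi_t(x_0,t_0)(t-t_0)|\le f(|x-x_0|)+\sigma(t-t_0)$ for all $(x,t)\in B_\delta(x_0)\times(t_0-\delta,t_0+\delta)$. $\varphi$ touches $u$ from below at $(x_0,t_0)\in\Theta$ if $u(x_0,t_0)=\varphi(x_0,t_0)$ and $u(x,t)>\varphi(x,t)$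 for all other $(x,t)\in\Theta$; touching from above is analogous. $u:\Theta\to\mathbb{R}\cup\{\infty\}$ is a viscosity supersolution if it is lower semicontinuous, finite in a dense subset of $\Theta$, and whenever an admissible $\varphi\in C^2(\Theta)$ touches $u$ from below at $(x_0,t_0)$ one has $\varphi_t(x_0,t_0)-F(D\varphi(x_0,t_0),D^2\varphi(x_0,t_0))\ge0$ if $D\varphi(x_0,t_0)\ne0$, and $\varphi_t(x_0,t_0)\ge0$ if $D\varphi(x_0,t_0)=0$. $u$ is a viscosity subsolution if it satisfies the analogous conditions with upper semicontinuity, touching from above and reversed inequalities. A continuous function that is both is a viscosity solution. *)

(* Defs.v *)
From HB Require Import structures.
From mathcomp Require Import all_boot all_order all_algebra.
From mathcomp Require Import all_classical all_reals all_analysis.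
Set Implicit Arguments.
Unset Strict Implicit.
Unset Printing Implicit Defensive.
Import Order.TTheory GRing.Theory Num.Theory.
Import numFieldNormedType.Exports.
Local Open Scope classical_set_scope.
Local Open Scope ring_scope.

(* Conventions. Points of R^n are row vectors; a space-time point is a pair
   z = (x, t) : 'rV[R]_n * R, and R^n x R stands for R^(n+1). A function on
   an open set Theta of space-time is a total function of which only the values
   on Theta are ever used. *)

(* The norm `|x| of the library on 'rV[R]_n is the sup norm. *)
Definition enorm (R : realType) (n : nat) (x : 'rV[R]_n) : R :=
  Num.sqrt (\sum_(i < n) x 0 i ^+ 2).

Definition gradient (R : realType) (n : nat) (f : 'rV[R]_n -> R)
    (x : 'rV[R]_n) : 'rV[R]_n :=
  \row_(i < n) 'D_(delta_mx 0 i) f x.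

Definition hessian (R : realType) (n : nat) (f : 'rV[R]_n -> R)
    (x : 'rV[R]_n) : 'M[R]_n :=
  \matrix_(i < n, j < n) 'D_(delta_mx 0 i) ('D_(delta_mx 0 j) f) x.

Definition space_gradient (R : realType) (n : nat) (phi : 'rV[R]_n * R -> R)
    (z : 'rV[R]_n * R) : 'rV[R]_n :=
  gradient (fun x => phi (x, z.2)) z.1.

Definition space_hessian (R : realType) (n : nat) (phi : 'rV[R]_n * R -> R)
    (z : 'rV[R]_n * R) : 'M[R]_n :=
  hessian (fun x => phi (x, z.2)) z.1.

Definition time_derivative (R : realType) (n : nat) (phi : 'rV[R]_n * R -> R)
    (z : 'rV[R]_n * R) : R :=
  derive1 (fun t => phi (z.1, t)) z.2.

(* F(xi, X); for a row vector xi, <X xi, xi> is the entry of xi X xi^T.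
   Only used for xi != 0. *)
Definition opF (R : realType) (n : nat) (p q : R) (xi : 'rV[R]_n)
    (X : 'M[R]_n) : R :=
  enorm xi `^ (q - 2) *
  (\tr X + (p - 2) * ((xi *m X *m xi^T) 0 0 / enorm xi ^+ 2)).

(* The n + 1 coordinate directions of space-time: [None] is time. *)
Definition axis (R : realType) (n : nat) (a : option 'I_n) : 'rV[R]_n * R :=
  if a is Some i then (delta_mx 0 i, 0) else (0, 1).

Definition C2_on (R : realType) (n : nat) (Theta : set ('rV[R]_n * R))
    (phi : 'rV[R]_n * R -> R) : Prop :=
  forall z, Theta z ->
  [/\ {for z, continuous phi},
      forall a, derivable phi z (axis R a) /\
                {for z, continuous ('D_(axis R a) phi)} &
      forall a b, derivable ('D_(axis R a) phi) z (axis R b) /\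
                  {for z, continuous ('D_(axis R b) ('D_(axis R a) phi))}].

(* f' is the derivative of f relative to D: one-sided at the endpoints of an
   interval D. *)
Definition derivative_on (R : realType) (D : set R) (f f' : R -> R) : Prop :=
  forall r, D r ->
  (f s - f r) / (s - r) @[s --> within D r^'] --> f' r.

Definition class_F (R : realType) (n : nat) (p q : R) (f : R -> R) : Prop :=
  exists f' f'' : R -> R,
  [/\ [/\ derivative_on `[0, +oo[ f f',
          derivative_on `[0, +oo[ f' f'' &
          {within `[0, +oo[, continuous f''}],
      [/\ f 0 = 0, f' 0 = 0 & f'' 0 = 0],
      forall r, 0 < r -> 0 < f'' r &
      let g := fun x : 'rV[R]_n => f (enorm x) in
      opF p q (gradient g x) (hessian g x) @[x --> (0 : 'rV[R]_n)^'] --> 0].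

Definition class_Sigma (R : realType) (sigma : R -> R) : Prop :=
  [/\ forall r, sigma (- r) = sigma r,
      (forall r, derivable sigma r 1) /\ continuous (derive1 sigma),
      sigma 0 = 0 /\ derive1 sigma 0 = 0 &
      forall r, r != 0 -> 0 < sigma r].

Definition cylinder (R : realType) (n : nat) (z : 'rV[R]_n * R) (delta : R) :
    set ('rV[R]_n * R) :=
  [set y | enorm (y.1 - z.1) < delta /\ `|y.2 - z.2| < delta].

Definition admissible (R : realType) (n : nat) (p q : R)
    (Theta : set ('rV[R]_n * R)) (phi : 'rV[R]_n * R -> R) : Prop :=
  C2_on Theta phi /\
  forall z, Theta z -> space_gradient phi z = 0 ->
  exists (delta : R) (f sigma : R -> R),
  [/\ 0 < delta, cylinder z delta `<=` Theta,
      class_F n p q f, class_Sigma sigma &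
      forall y, cylinder z delta y ->
      `|phi y - phi z - time_derivative phi z * (y.2 - z.2)|
        <= f (enorm (y.1 - z.1)) + sigma (y.2 - z.2)].

Definition touches_below (R : realType) (n : nat) (Theta : set ('rV[R]_n * R))
    (phi : 'rV[R]_n * R -> R) (u : 'rV[R]_n * R -> \bar R)
    (z : 'rV[R]_n * R) : Prop :=
  [/\ Theta z, u z = (phi z)%:E &
      forall y, Theta y -> y <> z -> ((phi y)%:E < u y)%E].

Definition touches_above (R : realType) (n : nat) (Theta : set ('rV[R]_n * R))
    (phi : 'rV[R]_n * R -> R) (u : 'rV[R]_n * R -> \bar R)
    (z : 'rV[R]_n * R) : Prop :=
  [/\ Theta z, u z = (phi z)%:E &
      forall y, Theta y -> y <> z -> (u y < (phi y)%:E)%E].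

(* Points outside Theta are isolated in [subspace Theta], so semicontinuity on
   [subspace Theta] is semicontinuity of the restriction of u to Theta. *)
Definition viscosity_supersolution (R : realType) (n : nat) (p q : R)
    (Theta : set ('rV[R]_n * R)) (u : 'rV[R]_n * R -> \bar R) : Prop :=
  [/\ forall z, Theta z -> u z <> -oo%E,
      lower_semicontinuous (u : subspace Theta -> \bar R),
      Theta `<=` closure (Theta `&` [set z | u z \is a fin_num]) &
      forall phi z, admissible p q Theta phi -> touches_below Theta phi u z ->
      (space_gradient phi z <> 0 ->
         0 <= time_derivative phi z
              - opF p q (space_gradient phi z) (space_hessian phi z)) /\
      (space_gradient phi z = 0 -> 0 <= time_derivative phi z)].

Definition viscosity_subsolution (R : realType) (n : nat) (p q : R)
    (Theta : set ('rV[R]_n * R)) (u : 'rV[R]_n * R -> \bar R) : Prop :=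
  [/\ forall z, Theta z -> u z <> +oo%E,
      lower_semicontinuous ((fun z => - u z)%E : subspace Theta -> \bar R),
      Theta `<=` closure (Theta `&` [set z | u z \is a fin_num]) &
      forall phi z, admissible p q Theta phi -> touches_above Theta phi u z ->
      (space_gradient phi z <> 0 ->
         time_derivative phi z
         - opF p q (space_gradient phi z) (space_hessian phi z) <= 0) /\
      (space_gradient phi z = 0 -> time_derivative phi z <= 0)].

Definition viscosity_solution (R : realType) (n : nat) (p q : R)
    (Theta : set ('rV[R]_n * R)) (u : 'rV[R]_n * R -> R) : Prop :=
  [/\ {within Theta, continuous u},
      viscosity_supersolution p q Theta (EFin \o u) &
      viscosity_subsolution p q Theta (EFin \o u)].

Definition positive_times (R : realType) (n : nat) : set ('rV[R]_n * R) :=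
  [set z | 0 < z.2].
Arguments positive_times : clear implicits.

Definition fict_dim (R : realType) (n : nat) (p q : R) : R :=
  (n%:R - 1) * (q - 1) / (p - 1) + 1.

Definition lambda (R : realType) (q d : R) : R := d * (q - 2) + q.

(* Meant for q > 2. *)
Definition barenblatt_slow (R : realType) (q d C r s : R) : R :=
  let l := lambda q d in
  s `^ (- (d / l)) *
  Num.max (C - (q - 2) / q * l `^ (1 / (1 - q))
               * (r / s `^ (1 / l)) `^ (q / (q - 1))) 0
    `^ ((q - 1) / (q - 2)).

(* Meant for 1 < q < 2 and lambda q d > 0. *)
Definition barenblatt_fast (R : realType) (q d C r s : R) : R :=
  let l := lambda q d in
  s `^ (- (d / l)) *
  (C + (2 - q) / q * l `^ (1 / (1 - q))
       * (r / s `^ (1 / l)) `^ (q / (q - 1)))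
    `^ (- ((q - 1) / (2 - q))).

Definition heat_kernel (R : realType) (p d C r t : R) : R :=
  C * t `^ (- (d / 2)) * expR (- (r ^+ 2 / (4 * (p - 1) * t))).

(* Main.v *)
Require Import Defs.
From HB Require Import structures.
From mathcomp Require Import all_boot all_order all_algebra.
From mathcomp Require Import all_classical all_reals all_analysis.
From mathcomp Require Import ring lra.
Set Implicit Arguments.
Unset Strict Implicit.
Unset Printing Implicit Defensive.
Import Order.TTheory GRing.Theory Num.Theory.
Import numFieldNormedType.Exports.
Local Open Scope classical_set_scope.
Local Open Scope ring_scope.

(** All three functions have the form [u(x,t) = V(|x|,t)], and they are checked
    point by point. Where [x <> 0] and [V_r <> 0], [u] is a classical solution:
    a test function touching it has the same gradient and time derivative and an
    ordered Hessian, and [F] is degenerate elliptic. Where [x <> 0] and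
    [V_r = 0] (outside the support of the slow profile and on its free
    boundary, where the power [(q-1)/(q-2) > 1] makes [u] differentiable), also
    [u_t = 0], and the conditions at critical points hold. At [x = 0], [u] has
    gradient zero and [u_t <= 0], which is what a subsolution needs; and no
    admissible test function touches from below, since there [u] decreases like
    [r^(q/(q-1))], whereas [f'^(q-1) = o(r)] and hence [f = o(r^(q/(q-1)))] for
    every [f] in the class [F]. *)

(** * Directional derivatives *)

(** The definitions provide partial derivatives only, whereas an ordered Hessian is a statement
    about all directions. So the test function is restricted to straight lines, where continuity of
    its partials yields the derivatives needed; the tests of one variable then give an inequality of
    quadratic forms, and ellipticity is proved in that form. The exponent [q / (q - 1)] at the
    centre is critical: for [g(x) = |x|^(q/(q-1))] the gradient has norm of order [r^(1/(q-1))], and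
    [F(Dg, D^2 g)] is a positive constant. Class F asks that this quantity tend to 0, so its members
    must be flatter than the tip of [u]. Correspondingly [u] is compared with test functions at the
    centre without any second derivative: the profile is written as a function [Phi] of
    [y = r^(q/(q-1))], and only the slope of [Phi] at 0 enters. *)

Lemma is_derive_fmul {R : realType} {V : normedModType R} (f g : V -> R)
    (x v : V) (df dg : R) :
  is_derive x v f df -> is_derive x v g dg ->
  is_derive x v (fun y => f y * g y) (df * g x + f x * dg).
Proof.
move=> hf hg; have := is_deriveM hf hg.
by rewrite addrC [g x *: _]mulrC.
Qed.

Lemma is_derive_fadd {R : realType} {V : normedModType R} (f g : V -> R)
    (x v : V) (df dg : R) :
  is_derive x v f df -> is_derive x v g dg ->
  is_derive x v (fun y => f y + g y) (df + dg).
Proof. by move=> hf hg; exact: is_deriveD. Qed.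

Lemma is_derive_fcst {R : realType} {V : normedModType R} (c : R) (x v : V) :
  is_derive x v (fun=> c) 0.
Proof. exact: is_derive_cst. Qed.

Lemma is_derive_fmulr {R : realType} {V : normedModType R} (f : V -> R)
    (c : R) (x v : V) (df : R) :
  is_derive x v f df -> is_derive x v (fun y => f y * c) (df * c).
Proof.
move=> hf; have := is_derive_fmul hf (is_derive_fcst c x v).
by rewrite mulr0 addr0.
Qed.

(** The two difference quotients coincide. The base point is [s *: v + x] rather than [x], so that
    the derivative is available all along the line, as the mean value theorem and second derivatives
    require. *)
Lemma is_derive_line {R : realType} {V W : normedModType R} (f : V -> W)
    (x v : V) (s : R) (df : W) :
  is_derive (s *: v + x) v f df <->
  is_derive s 1 (fun h : R => f (h *: v + x)) df.
Proof.
rewrite /derive /derivable.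
suff E : (fun h : R => h^-1 *: ((f \o shift (s *: v + x)) (h *: v)
                                - f (s *: v + x))) =
         (fun h : R => h^-1 *: (((fun h => f (h *: v + x)) \o shift s)
                                  (h *: (1 : R))
                                - f (s *: v + x))).
  by split=> -[c d]; split; move: c d; rewrite /derivable /derive ?E -?E.
by apply/funext => h /=; rewrite [_%:A]mulr1 scalerDl addrA.
Qed.

Lemma mean_value0 {R : realType} (g dg : R -> R) (s : R) :
  s != 0 -> (forall c : R, `|c| <= `|s| -> is_derive c 1 g (dg c)) ->
  exists c : R, [/\ `|c| <= `|s|, 0 < c * s & g s - g 0 = dg c * s].
Proof.
move=> s0 dgP.
have gc (a b : R) : `|a| <= `|s| -> `|b| <= `|s| ->
    {within `[a, b], continuous g}.
  move=> ha hb; apply: continuous_in_subspaceT => c; rewrite inE/= in_itv/=.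
  move=> /andP[ac cb]; apply/differentiable_continuous/derivable1_diffP.
  apply: (@ex_derive _ _ _ _ _ _ (dg c)); apply: dgP; rewrite ler_norml.
  by move: ha hb; rewrite !ler_norml => /andP[h1 _] /andP[_ h2];
    rewrite (le_trans h1 ac) (le_trans cb h2).
move: s0; rewrite neq_lt => /orP[] s0.
- have [| |c] := @MVT R g dg s 0 s0.
  + move=> c; rewrite in_itv/= => /andP[h1 h2]; apply: dgP.
    by rewrite !ltr0_norm// lerN2 ltW.
  + by apply: gc; rewrite ?normr0.
  + rewrite in_itv/= sub0r => /andP[h1 h2] e; exists c; split.
    * by rewrite !ltr0_norm// lerN2 ltW.
    * by rewrite nmulr_rgt0.
    * by rewrite -opprB e mulrN opprK.
- have [| |c] := @MVT R g dg 0 s s0.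
  + move=> c; rewrite in_itv/= => /andP[h1 h2]; apply: dgP.
    by rewrite !gtr0_norm// ltW.
  + by apply: gc; rewrite ?normr0.
  + rewrite in_itv/= subr0 => /andP[h1 h2] ?; exists c; split => //.
    * by rewrite !gtr0_norm// ltW.
    * by rewrite mulr_gt0.
Qed.

Lemma is_deriveE {R : realType} {V W : normedModType R} (f : V -> W) (x v : V)
    (l : W) :
  is_derive x v f l <-> h^-1 *: (f (h *: v + x) - f x) @[h --> 0^'] --> l.
Proof.
split=> [[df <-]|c]; first exact: df.
split; first by apply/cvg_ex; exists l.
exact: cvg_lim.
Qed.

(** The increment is split at [s *: b + x]. The mean value theorem turns the part along [a] into
    ['D_a h] at a nearby point, which tends to ['D_a h x] by continuity; the part along [b] is the
    difference quotient of the last hypothesis. *)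
Lemma is_derive_dirD {R : realType} {V : normedModType R} (h : V -> R)
    (x a b : V) (l : R) :
  (\forall y \near x, derivable h y a) ->
  {for x, continuous ('D_a h)} ->
  is_derive x b h l -> is_derive x (a + b) h ('D_a h x + l).
Proof.
move=> da ca /is_deriveE hb; apply/is_deriveE.
rewrite (_ : (fun s => _) = (fun s : R =>
  s^-1 *: (h (s *: (a + b) + x) - h (s *: b + x)) +
  s^-1 *: (h (s *: b + x) - h x))); last first.
  by apply/funext => s; rewrite -scalerDr addrA subrK.
apply: cvgD => //; apply/cvgrPdist_le => eps eps0.
have /nbhs_ballP[e /= e0 He] : \forall y \near x,
    derivable h y a /\ `|'D_a h x - 'D_a h y| <= eps.
  near=> y; split; first by near: y.
  by near: y; move/cvgrPdist_le : ca; apply.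
(* With this [d], all points [t *: a + (s *: b + x)] with [|t| <= |s| < d] stay in the ball of
   radius [e]; the [+ 1] keeps the denominator positive when [a = b = 0]. *)
pose d := e / (`|a| + `|b| + 1).
have K0 : 0 < `|a| + `|b| + 1 by rewrite ltr_wpDl// addr_ge0.
have d0 : 0 < d by rewrite divr_gt0.
have Hd s t : `|s| < d -> `|t| <= `|s| -> ball x e (t *: a + (s *: b + x)).
  move=> sd td; rewrite -ball_normE /= addrA opprD addrCA subrr addr0.
  rewrite normrN (le_lt_trans (ler_normD _ _))// !normrZ.
  have -> : e = d * (`|a| + `|b| + 1) by rewrite /d divfK// gt_eqF.
  have ta : `|t| * `|a| <= d * `|a| by rewrite ler_wpM2r// (le_trans td)// ltW.
  have sb : `|s| * `|b| <= d * `|b| by rewrite ler_wpM2r// ltW.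
  by rewrite !mulrDr mulr1 (le_lt_trans (lerD ta sb))// ltrDl.
near=> s.
have s0 : s != 0 by near: s; exact: nbhs_dnbhs_neq.
have sd : `|s| < d.
  near: s; apply: dnbhs0_lt => //.
have [c|c [cs _]] := @mean_value0 _ (fun t => h (t *: a + (s *: b + x)))
  (fun t => 'D_a h (t *: a + (s *: b + x))) s s0.
  move=> cs; apply: (is_derive_line _ _ _ _ _).1.
  apply: derivableP; exact: (He _ (Hd _ _ sd cs)).1.
rewrite scale0r add0r => E.
rewrite (_ : s *: (a + b) + x = s *: a + (s *: b + x)) ?E; last first.
  by rewrite scalerDr addrA.
rewrite -[_ *: _]/(_ * _) mulrCA mulVf// mulr1.
exact: (He _ (Hd _ _ sd cs)).2.
Unshelve. all: by end_near. Qed.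

Lemma is_derive_dirZ {R : realType} {V : normedModType R} (h : V -> R)
    (x a : V) (c l : R) :
  is_derive x a h l -> is_derive x (c *: a) h (c * l).
Proof.
rewrite -[x in is_derive x a](add0r x) -[x in is_derive x (c *: a)](add0r x).
rewrite -[in X in X -> _](scale0r a) -[in X in _ -> X](scale0r (c *: a)).
move=> /(is_derive_line h x a 0 l).1 dh.
apply: (is_derive_line h x (c *: a) 0 (c * l)).2.
rewrite (_ : (fun s => _) = (fun s : R => h (s *: a + x)) \o (fun s => s * c)).
  rewrite mulrC; apply: is_derive1_comp; first by rewrite mul0r.
  rewrite -[X in is_derive _ _ _ X]mul1r.
  by apply: is_derive_fmulr; exact: is_derive_id.
by apply/funext => s /=; rewrite scalerA.
Qed.

(** Induction on [r]: in [is_derive_dirD] the head is the direction with a continuous derivative,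
    the tail the one handled by the induction hypothesis. *)
Lemma is_derive_sum_dir {R : realType} {V : normedModType R} (I : Type)
    (r : seq I) (b : I -> V) (c : I -> R) (h : V -> R) (x : V) :
  (forall i, \forall y \near x, derivable h y (b i)) ->
  (forall i, {for x, continuous ('D_(b i) h)}) ->
  is_derive x (\sum_(i <- r) c i *: b i) h (\sum_(i <- r) c i * 'D_(b i) h x).
Proof.
move=> dh ch; elim: r => [|i r IH].
  by rewrite !big_nil; exact: is_derive0.
rewrite !big_cons.
have dZ (y : V) : derivable h y (b i) ->
    is_derive y (c i *: b i) h (c i * 'D_(b i) h y).
  by move=> /derivableP; exact: is_derive_dirZ.
have DE : 'D_(c i *: b i) h x = c i * 'D_(b i) h x.
  by apply: derive_val; apply: dZ; exact: nbhs_singleton (dh i).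
rewrite -DE.
apply: is_derive_dirD => //.
  near=> y; apply: (@ex_derive _ _ _ _ _ _ (c i * 'D_(b i) h y)).
  by apply: dZ; near: y; exact: dh.
have : (c i * 'D_(b i) h y) @[y --> x] --> c i * 'D_(b i) h x.
  by apply: cvgM; [exact: cvg_cst|exact: ch].
rewrite /prop_for /continuous_at DE.
apply: cvg_trans; apply: near_eq_cvg.
near=> y; apply/esym; apply: derive_val; by apply: dZ; near: y; exact: dh.
Unshelve. all: by end_near. Qed.

(** * Extremum tests in one variable *)

Lemma dnbhs_dist {R : realType} (P : R -> Prop) :
  (\forall s \near 0^', P s) <->
  exists2 d : R, 0 < d & forall s, s != 0 -> `|s| < d -> P s.
Proof.
split.
  move=> /nbhs_ballP[d /= d0 H]; exists d => // s s0 sd.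
  by apply: (H s) => //; rewrite -ball_normE /= sub0r normrN.
move=> [d d0 H]; apply/nbhs_ballP; exists d => //= s.
by rewrite -ball_normE /= sub0r normrN => sd s0; exact: H.
Qed.

Lemma is_derive_local_min {R : realType} (w : R -> R) (x d : R) :
  is_derive x 1 w d -> (\forall y \near x, w x <= w y) -> d = 0.
Proof.
move=> /is_deriveE dw /nbhs_ballP[e /= e0 He].
apply/eqP/negPn/negP => d0.
have [f f0 Hf] : exists2 f : R, 0 < f & forall s, s != 0 -> `|s| < f ->
    `|d - s^-1 *: (w (s *: 1 + x) - w x)| < `|d|.
  by apply/dnbhs_dist; move/cvgrPdist_lt : dw; apply; rewrite normr_gt0.
pose m := Num.min e f / 2.
have m0 : 0 < m by rewrite divr_gt0// lt_min e0 f0.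
have [me mf] : m < e /\ m < f.
  apply/andP; rewrite -lt_min /m ltr_pdivrMr// mulr_natr mulr2n ltrDl.
  by rewrite lt_min e0.
(* A step against the sign of [d]: at a minimum the difference quotient for this [s] is zero or of
   sign opposite to [d], hence at distance at least [|d|] from [d]. *)
pose s := - Num.sg d * m.
have s0 : s != 0 by rewrite mulf_neq0// ?oppr_eq0 ?sgr_eq0// gt_eqF.
have ns : `|s| = m by rewrite normrM normrN normr_sg d0 mul1r gtr0_norm.
have H1 : 0 <= w (s *: 1 + x) - w x.
  rewrite subr_ge0; apply: He; rewrite -ball_normE /= opprD addrCA subrr addr0.
  by rewrite normrN [_%:A]mulr1 ns.
have := Hf s s0; rewrite ns => /(_ mf).
apply/negP; rewrite -leNgt.
rewrite -[_ *: _]/(_ * _); move: (_ - w x) H1 => k H1.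
have E : s^-1 * k = - Num.sg d * (m^-1 * k).
  rewrite /s invfM mulrA; congr (_ * _ * _).
  by move: d0; rewrite neq_lt => /orP[] d0;
     rewrite ?(ltr0_sg d0) ?(gtr0_sg d0) ?opprK ?invrN ?invr1.
have K0 : 0 <= m^-1 * k by rewrite mulr_ge0// invr_ge0 ltW.
have -> : d - s^-1 * k = Num.sg d * (`|d| + m^-1 * k).
  by rewrite E mulNr opprK mulrDr -[in RHS]numEsg.
rewrite normrM normr_sg d0 mul1r (ger0_norm (addr_ge0 _ _))//.
by rewrite lerDl.
Qed.

(** By the first-order test [w1] vanishes at 0. If [c < 0], then [w1] is negative just to the right
    of 0, and the mean value theorem makes [w] drop below [w 0]. *)
Lemma second_order_local_min {R : realType} (w w1 : R -> R) (c : R) :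
  (\forall s \near (0 : R), is_derive (s : R) 1 w (w1 s)) ->
  is_derive (0 : R) 1 w1 c ->
  (\forall s \near (0 : R), w 0 <= w s) -> 0 <= c.
Proof.
move=> dw dw1 wmin.
have w10 : w1 0 = 0 by exact: is_derive_local_min (nbhs_singleton dw) wmin.
rewrite leNgt; apply/negP => c0.
move/is_deriveE : dw1 => dw1.
have [f f0 Hf] : exists2 f : R, 0 < f & forall s, s != 0 -> `|s| < f ->
    `|c - s^-1 *: (w1 (s *: 1 + 0) - w1 0)| < - c.
  by apply/dnbhs_dist; move/cvgrPdist_lt : dw1; apply; rewrite oppr_gt0.
have Hneg s : 0 < s -> s < f -> w1 s < 0.
  move=> s0 sf; have := Hf s; rewrite gt_eqF// gtr0_norm// => /(_ isT sf).
  rewrite w10 subr0 addr0 [_%:A]mulr1 ltr_norml opprK => /andP[+ _].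
  rewrite -[_ *: _]/(_ * _) => h1.
  have : s^-1 * w1 s < 0 by lra.
  by rewrite pmulr_rlt0// invr_gt0.
have /nbhs_ballP[e /= e0 He] : \forall s \near (0 : R),
    is_derive (s : R) 1 w (w1 s) /\ w 0 <= w s.
  by near=> s; split; near: s.
pose m := Num.min e f / 2.
have m0 : 0 < m by rewrite divr_gt0// lt_min e0 f0.
have [me mf] : m < e /\ m < f.
  apply/andP; rewrite -lt_min /m ltr_pdivrMr// mulr_natr mulr2n ltrDl.
  by rewrite lt_min e0.
have B s : `|s| <= m -> ball (0 : R) e s.
  by move=> h; rewrite -ball_normE /= sub0r normrN (le_lt_trans h).
have [||t [tm t0 E]] := @mean_value0 _ w w1 m; first by rewrite gt_eqF.
  by move=> s; rewrite (gtr0_norm m0) => h; exact: (He _ (B _ h)).1.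
have {}t0 : 0 < t by move: t0; rewrite pmulr_lgt0.
have := (He m (B _ _)).2; rewrite gtr0_norm// lexx => /(_ isT).
rewrite -subr_ge0 E; apply/negP; rewrite -ltNge nmulr_rlt0// Hneg//.
rewrite (le_lt_trans _ mf)// (le_trans (ler_norm _))// (le_trans tm)//.
by rewrite gtr0_norm.
Unshelve. all: by end_near. Qed.

(** * Test functions along lines *)

Lemma near_line {R : realType} {V : normedModType R} (P : V -> Prop) (x v : V) :
  (\forall y \near x, P y) -> \forall s \near (0 : R), P (s *: v + x).
Proof.
have c : (fun s : R => s *: v + x) @ (0 : R) --> x.
  rewrite -[X in _ --> X]add0r -(scale0r v); apply: cvgD; last exact: cvg_cst.
  exact: scalel_continuous.
exact: c.
Qed.

(** [C2_on] differentiates along the axes of space-time, the equation with the other variable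
    frozen; here and in the next two lemmas the difference quotients are the same. *)
Lemma space_gradientE {R : realType} (n : nat) (phi : 'rV[R]_n * R -> R)
    (z : 'rV[R]_n * R) i :
  space_gradient phi z 0 i = 'D_(axis R (Some i)) phi z.
Proof.
case: z => x t; rewrite mxE /derive /=.
apply: (congr1 (fun f : R -> R => lim (f @ 0^'))); apply/funext => h.
by congr (_ *: (phi _ - _)); congr pair; rewrite /= scaler0 add0r.
Qed.

Lemma space_hessianE {R : realType} (n : nat) (phi : 'rV[R]_n * R -> R)
    (z : 'rV[R]_n * R) i j :
  space_hessian phi z i j =
  'D_(axis R (Some i)) ('D_(axis R (Some j)) phi) z.
Proof.
rewrite -space_gradientE /space_gradient /space_hessian [LHS]mxE [RHS]mxE.
apply: (congr1 (fun f : 'rV[R]_n -> R => 'D_(delta_mx 0 i) f z.1)).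
by apply/funext => x; rewrite -space_gradientE [RHS]mxE.
Qed.

Lemma time_derivativeE {R : realType} (n : nat) (phi : 'rV[R]_n * R -> R)
    (z : 'rV[R]_n * R) :
  time_derivative phi z = 'D_(axis R None) phi z.
Proof.
case: z => x t; rewrite /time_derivative derive1E /derive /=.
apply: (congr1 (fun f : R -> R => lim (f @ 0^'))); apply/funext => h.
by congr (_ *: (phi _ - _)); congr pair; rewrite /= scaler0 add0r.
Qed.

Lemma space_direction {R : realType} (n : nat) (e : 'rV[R]_n) :
  (e, 0) = \sum_i e 0 i *: axis R (Some i) :> 'rV[R]_n * R.
Proof.
rewrite [in LHS](row_sum_delta e).
elim/big_rec2: _ => // i y1 y2 _ <-.
by congr pair; rewrite /= scaler0 addr0.
Qed.

Section C2_line.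
Context {R : realType} (n : nat) (Theta : set ('rV[R]_n * R)).
Variables (phi : 'rV[R]_n * R -> R) (z : 'rV[R]_n * R) (e : 'rV[R]_n).
Hypothesis openTheta : open Theta.
Hypothesis phiC2 : C2_on Theta phi.
Hypothesis Theta_z : Theta z.

Let near_Theta y : Theta y -> \forall x \near y, Theta x.
Proof. by move=> Ty; exact: open_nbhs_nbhs. Qed.

Lemma C2_on_line :
  \forall s \near (0 : R),
    is_derive (s : R) 1 (fun s => phi (s *: (e, 0) + z))
      (\sum_i e 0 i * 'D_(axis R (Some i)) phi (s *: (e, 0) + z)).
Proof.
near=> s.
have Ts : Theta (s *: (e, 0) + z).
  by near: s; apply: (@near_line _ _ Theta); exact: near_Theta.
apply: (is_derive_line _ _ _ _ _).1.
rewrite [X in is_derive _ X](space_direction e).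
apply: is_derive_sum_dir => i.
  near=> y; have Ty : Theta y by near: y; exact: near_Theta.
  by have [_ /(_ (Some i))[]] := phiC2 Ty.
by have [_ /(_ (Some i))[]] := phiC2 Ts.
Unshelve. all: by end_near. Qed.

Lemma C2_on_line2 :
  is_derive (0 : R) 1
    (fun s => \sum_i e 0 i * 'D_(axis R (Some i)) phi (s *: (e, 0) + z))
    ((e *m space_hessian phi z *m e^T) 0 0).
Proof.
pose D i := 'D_(axis R (Some i)) phi.
(* Entry [(j, i)] of the Hessian is the derivative along [j] of [D i], so the product with [e] on
   the left is the derivative of each [D i] along [e]. *)
have E : (e *m space_hessian phi z *m e^T) 0 0 =
    \sum_i (\sum_j e 0 j * 'D_(axis R (Some j)) (D i) z) * e 0 i.
  rewrite mxE; apply: eq_bigr => i _; rewrite !mxE; congr (_ * _).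
  by apply: eq_bigr => j _; rewrite space_hessianE.
rewrite E.
have -> : (fun s : R => \sum_i e 0 i * D i (s *: (e, 0) + z)) =
    \sum_i (fun s : R => D i (s *: (e, 0) + z) * e 0 i).
  by apply/funext => s; rewrite fct_sumE; apply: eq_bigr => i _; rewrite mulrC.
apply: is_derive_sum => i.
apply: is_derive_fmulr; apply: (is_derive_line _ _ _ _ _).1.
rewrite scale0r add0r [X in is_derive _ X](space_direction e).
apply: is_derive_sum_dir => j.
  near=> y; have Ty : Theta y by near: y; exact: near_Theta.
  by have [_ _ /(_ (Some i) (Some j))[]] := phiC2 Ty.
by have [_ _ /(_ (Some i) (Some j))[]] := phiC2 Theta_z.
Unshelve. all: by end_near. Qed.

Lemma C2_on_time :
  is_derive z.2 1 (fun t => phi (z.1, t)) (time_derivative phi z).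
Proof.
have [_ /(_ None)[/derivableP d _] _] := phiC2 Theta_z.
rewrite time_derivativeE; apply/is_deriveE; move/is_deriveE : d.
apply: cvg_trans; apply: near_eq_cvg; near=> h.
rewrite -[in RHS](surjective_pairing z) //.
by congr (_ *: (phi _ - phi _)); case: (z) => x t //=;
  congr pair; rewrite /= scaler0 add0r.
Unshelve. all: by end_near. Qed.

End C2_line.

(** * Ellipticity and radial functions *)

(* Sum over [i, j] the form at [xi_j e_i - xi_i e_j]; in this way no symmetry of
   [Y] is needed. *)
Lemma form_le_trace {R : realType} (n : nat) (Y : 'M[R]_n) (xi : 'rV[R]_n) :
  (forall e : 'rV[R]_n, 0 <= (e *m Y *m e^T) 0 0) ->
  (xi *m Y *m xi^T) 0 0 <= (\sum_i xi 0 i ^+ 2) * \tr Y.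
Proof.
pose B (a b : 'rV[R]_n) := (a *m Y *m b^T) 0 0.
have Bl c a d a' b : B (c *: a + d *: a') b = c * B a b + d * B a' b.
  by rewrite /B !mulmxDl -!scalemxAl mxE [X in X + _]mxE [X in _ + X]mxE.
have Br c a d a' b : B b (c *: a + d *: a') = c * B b a + d * B b a'.
  rewrite /B linearD /= !linearZ /= !mulmxDr -!scalemxAr.
  by rewrite mxE [X in X + _]mxE [X in _ + X]mxE.
have Bd i j : B (delta_mx 0 i) (delta_mx 0 j) = Y i j.
  by rewrite /B -rowE trmx_delta -colE !mxE.
move=> Y0.
have H i j : 0 <= xi 0 j ^+ 2 * Y i i + xi 0 i ^+ 2 * Y j j
                  - (xi 0 i * Y i j * xi 0 j + xi 0 j * Y j i * xi 0 i).
  have : 0 <= B (xi 0 j *: delta_mx 0 i + - xi 0 i *: delta_mx 0 j)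
                (xi 0 j *: delta_mx 0 i + - xi 0 i *: delta_mx 0 j).
    exact: Y0.
  rewrite Bl !Br !Bd; congr (_ <= _); ring.
pose S := \sum_i xi 0 i ^+ 2.
have S1 : \sum_i \sum_j xi 0 j ^+ 2 * Y i i = S * \tr Y.
  by rewrite mulr_sumr; apply: eq_bigr => i _; rewrite -mulr_suml.
have S2 : \sum_i \sum_j xi 0 i ^+ 2 * Y j j = S * \tr Y.
  by rewrite exchange_big.
have S3 : \sum_i \sum_j xi 0 j * Y j i * xi 0 i = B xi xi.
  by rewrite /B mxE; apply: eq_bigr => i _; rewrite !mxE mulr_suml.
have S4 : \sum_i \sum_j xi 0 i * Y i j * xi 0 j = B xi xi.
  by rewrite exchange_big.
have : 0 <= \sum_i \sum_j (xi 0 j ^+ 2 * Y i i + xi 0 i ^+ 2 * Y j j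
                  - (xi 0 i * Y i j * xi 0 j + xi 0 j * Y j i * xi 0 i)).
  by apply: sumr_ge0 => i _; apply: sumr_ge0 => j _.
under eq_bigr do rewrite sumrB !big_split /=.
rewrite sumrB !big_split /= S1 S2 S3 S4 -/S -/(B xi xi); lra.
Qed.

Lemma sum_sqr_ge0 {R : realType} (n : nat) (x : 'rV[R]_n) :
  0 <= \sum_i x 0 i ^+ 2.
Proof. by apply: sumr_ge0 => i _; exact: sqr_ge0. Qed.

Lemma enorm_sqr {R : realType} (n : nat) (x : 'rV[R]_n) :
  enorm x ^+ 2 = \sum_i x 0 i ^+ 2.
Proof. by rewrite sqr_sqrtr// sum_sqr_ge0. Qed.

Lemma enorm_ge0 {R : realType} (n : nat) (x : 'rV[R]_n) : 0 <= enorm x.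
Proof. exact: sqrtr_ge0. Qed.

Lemma enorm_eq0 {R : realType} (n : nat) (x : 'rV[R]_n) :
  (enorm x == 0) = (x == 0).
Proof.
rewrite -sqrf_eq0 enorm_sqr psumr_eq0; last by move=> i _; exact: sqr_ge0.
apply/allP/eqP => [H|-> i _].
  apply/rowP => i; rewrite mxE; apply/eqP; rewrite -sqrf_eq0.
  by apply: H; rewrite mem_index_enum.
by rewrite /= mxE expr0n eqxx.
Qed.

Lemma enorm0 {R : realType} (n : nat) : enorm (0 : 'rV[R]_n) = 0.
Proof. by apply/eqP; rewrite enorm_eq0. Qed.

Lemma enorm_gt0 {R : realType} (n : nat) (x : 'rV[R]_n) :
  (0 < enorm x) = (x != 0).
Proof. by rewrite lt_neqAle enorm_ge0 andbT eq_sym enorm_eq0. Qed.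

Lemma enormZ {R : realType} (n : nat) (a : R) (x : 'rV[R]_n) :
  enorm (a *: x) = `|a| * enorm x.
Proof.
rewrite /enorm -sqrtr_sqr -sqrtrM ?sqr_ge0//; congr Num.sqrt.
by rewrite mulr_sumr; apply: eq_bigr => i _; rewrite mxE exprMn.
Qed.

(* For [1 < p < 2] the second summand of [opF] is negative; it is controlled by
   the trace since the form is at most [\tr Y] on unit vectors. *)
Lemma opF_form_ge0 {R : realType} (n : nat) (p q : R) (xi : 'rV[R]_n)
    (Y : 'M[R]_n) : 1 < p -> xi != 0 ->
  (forall e : 'rV[R]_n, 0 <= (e *m Y *m e^T) 0 0) -> 0 <= opF p q xi Y.
Proof.
move=> p1 xi0 Y0; rewrite /opF mulr_ge0 ?powR_ge0//.
have n0 : 0 < enorm xi ^+ 2 by rewrite exprn_gt0// enorm_gt0.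
set k := _ / _.
have k0 : 0 <= k by rewrite divr_ge0 ?Y0// ltW.
have kt : k <= \tr Y.
  by rewrite ler_pdivrMr// mulrC enorm_sqr; exact: form_le_trace.
have := mulr_ge0 (ltW (_ : 0 < p - 1)) k0; rewrite subr_gt0 p1 => /(_ isT).
rewrite [(p - 1) * k]mulrBl [(p - 2) * k]mulrBl; lra.
Qed.

Lemma opFB {R : realType} (n : nat) (p q : R) (xi : 'rV[R]_n) (X Y : 'M[R]_n) :
  opF p q xi (X - Y) = opF p q xi X - opF p q xi Y.
Proof.
rewrite /opF linearB /= mulmxBr mulmxBl.
rewrite [X in _ + _ * (X / _)]mxE [X in _ + _ * ((_ + X) / _)]mxE; ring.
Qed.

Lemma opFZ {R : realType} (n : nat) (p q c : R) (xi : 'rV[R]_n) (X : 'M[R]_n) :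
  opF p q xi (c *: X) = c * opF p q xi X.
Proof.
rewrite /opF linearZ /= -scalemxAr -scalemxAl.
rewrite [X in _ + _ * (X / _)]mxE; ring.
Qed.

(** The Hessian at [x] of [h(|x|)] with [h' = h1] and [h'' = h2]: eigenvalue [h2] in the direction
    of [x] and [h1 / |x|] on its orthogonal complement. *)
Definition radial_hessian {R : realType} (n : nat) (h1 h2 : R) (x : 'rV[R]_n) :
    'M[R]_n :=
  ((h2 - h1 / enorm x) / enorm x ^+ 2) *: (x^T *m x) +
  (h1 / enorm x) *: 1%:M.

(** The gradient is an eigenvector of the radial Hessian for [h2], so the normalized infinity
    Laplacian is [h2]; the trace adds [n - 1] tangential eigenvalues [h1 / |x|]. *)
Lemma opF_radial {R : realType} (n : nat) (p q h1 h2 : R) (x : 'rV[R]_n) :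
  x != 0 -> h1 != 0 ->
  opF p q ((h1 / enorm x) *: x) (radial_hessian h1 h2 x) =
  `|h1| `^ (q - 2) * ((p - 1) * h2 + (n%:R - 1) * h1 / enorm x).
Proof.
move=> x0 h10; have r0 : enorm x != 0 by rewrite enorm_eq0.
have xx : x *m x^T = (enorm x ^+ 2)%:M.
  apply/rowP => i; rewrite ord1 !mxE enorm_sqr mulr1n.
  by apply: eq_bigr => j _; rewrite mxE expr2.
rewrite /opF; congr (_ * _).
  congr (_ `^ _).
  by rewrite enormZ normrM normfV (ger0_norm (enorm_ge0 x)) divfK.
pose r := enorm x; rewrite -/r in xx r0 *.
have T : \tr (radial_hessian h1 h2 x) = (h2 - h1 / r) + h1 / r * n%:R.
  rewrite /radial_hessian linearD /= !linearZ /= mxtrace1 mxtrace_mulC xx.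
  by rewrite mxtrace_scalar mulr1n -/r divfK// expf_neq0.
have F : x *m radial_hessian h1 h2 x *m x^T = (h2 * r ^+ 2)%:M.
  rewrite /radial_hessian -/r mulmxDr -!scalemxAr mulmx1 mulmxA xx.
  rewrite mul_scalar_mx mulmxDl -!scalemxAl xx !scale_scalar_mx -raddfD /=.
  congr (_%:M); field; exact: r0.
rewrite T [(_ *: x)^T]linearZ /= -scalemxAr -!scalemxAl F enormZ -/r.
rewrite !scale_scalar_mx.
rewrite mxE mulr1n exprMn real_normK ?num_real//.
field; by rewrite h10 r0.
Qed.

(** * Differentiation of radial functions *)

Lemma is_derive_chain {R : realType} {V : normedModType R} (h : R -> R)
    (f : V -> R) (x v : V) (dh df : R) :
  is_derive (f x) 1 h dh -> is_derive x v f df ->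
  is_derive x v (h \o f) (dh * df).
Proof.
have E : x = (0 : R) *: v + x by rewrite scale0r add0r.
move=> hh; rewrite {1}E => /(is_derive_line _ _ _ _ _).1 hf.
rewrite E; apply: (is_derive_line _ _ _ _ _).2.
by apply: (is_derive1_comp (f := h)) => //=; rewrite -E.
Qed.

Definition dotrv {R : realType} (n : nat) (a b : 'rV[R]_n) : R :=
  \sum_i a 0 i * b 0 i.

Lemma dotrv_delta {R : realType} (n : nat) (x : 'rV[R]_n) i :
  dotrv x (delta_mx 0 i) = x 0 i.
Proof.
rewrite /dotrv (bigD1 i)//= big1 ?addr0.
  by rewrite mxE !eqxx mulr1.
by move=> j /negbTE ji; rewrite mxE ji andbF mulr0.
Qed.

Lemma dotrvv {R : realType} (n : nat) (x : 'rV[R]_n) :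
  dotrv x x = enorm x ^+ 2.
Proof. by rewrite enorm_sqr; apply: eq_bigr => i _; rewrite expr2. Qed.

Lemma enorm_delta {R : realType} (n : nat) (i : 'I_n) :
  enorm (delta_mx 0 i : 'rV[R]_n) = 1.
Proof.
apply/eqP; rewrite -(@eqrXn2 _ 2) ?enorm_ge0 ?ler01// expr1n -dotrvv.
by rewrite dotrv_delta mxE !eqxx.
Qed.

Lemma radial_hessian_form {R : realType} (n : nat) (h1 h2 : R)
    (x e : 'rV[R]_n) :
  (e *m radial_hessian h1 h2 x *m e^T) 0 0 =
  (h2 - h1 / enorm x) / enorm x ^+ 2 * dotrv x e ^+ 2 +
  h1 / enorm x * dotrv e e.
Proof.
have E (a b : 'rV[R]_n) : (a *m b^T) = (dotrv a b)%:M.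
  apply/rowP => i; rewrite ord1 !mxE mulr1n.
  by apply: eq_bigr => j _; rewrite !mxE.
have C : dotrv e x = dotrv x e by apply: eq_bigr => i _; rewrite mulrC.
rewrite /radial_hessian mulmxDr -!scalemxAr mulmx1 mulmxA mulmxDl -!scalemxAl.
rewrite (E e x) mul_scalar_mx -scalemxAl !E C.
rewrite !scale_scalar_mx -raddfD mxE mulr1n.
by rewrite expr2 mulrA.
Qed.

Lemma radial_hessian_entry {R : realType} (n : nat) (h1 h2 : R)
    (x : 'rV[R]_n) i j :
  radial_hessian h1 h2 x i j =
  (h2 - h1 / enorm x) / enorm x ^+ 2 * (x 0 i * x 0 j) +
  h1 / enorm x * dotrv (delta_mx 0 i) (delta_mx 0 j : 'rV[R]_n).
Proof.
rewrite dotrv_delta !mxE big_ord1 !mxE eqxx /= eq_sym.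
by case: (i == j).
Qed.

Section radial_derive.
Context {R : realType} (n : nat).
Implicit Types x a b : 'rV[R]_n.

Lemma is_derive_dotrv x a b : is_derive x a (fun y => dotrv y b) (dotrv a b).
Proof.
rewrite -{1}(add0r x) -(scale0r a); apply: (is_derive_line _ _ _ _ _).2.
have -> : (fun s : R => dotrv (s *: a + x) b) =
          (fun s : R => s * dotrv a b + dotrv x b).
  apply/funext => s; rewrite /dotrv mulr_sumr -big_split; apply: eq_bigr => i _.
  by rewrite !mxE mulrDl mulrA.
rewrite -[X in is_derive _ _ _ X]addr0.
apply: (@is_derive_fadd _ _ (fun s : R => s * _) (fun=> _)) => /=.
rewrite -[X in is_derive _ _ _ X]mul1r.
by apply: is_derive_fmulr; exact: is_derive_id.
Qed.

Lemma is_derive_enorm x a :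
  x != 0 -> is_derive x a (@enorm R n) (dotrv x a / enorm x).
Proof.
move=> x0.
have r0 : enorm x != 0 by rewrite enorm_eq0.
have -> : dotrv x a / enorm x =
    (2 * Num.sqrt (dotrv x x))^-1 * (dotrv x a + dotrv x a).
  by rewrite dotrvv sqrtr_sqr ger0_norm ?enorm_ge0//; field.
have -> : @enorm R n = Num.sqrt \o (fun y => dotrv y y).
  by apply/funext => y /=; rewrite dotrvv sqrtr_sqr ger0_norm ?enorm_ge0.
apply: is_derive_chain.
  by apply: is_derive1_sqrt; rewrite dotrvv exprn_gt0// enorm_gt0.
have -> : (fun y => dotrv y y) = \sum_i (fun y : 'rV[R]_n => y 0 i * y 0 i).
  by apply/funext => y; rewrite fct_sumE.
rewrite /dotrv -big_split /=; apply: is_derive_sum => i.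
have H : is_derive x a (fun y : 'rV[R]_n => y 0 i) (a 0 i).
  have := is_derive_dotrv x a (delta_mx 0 i); rewrite dotrv_delta.
  by under eq_fun do rewrite dotrv_delta.
by have := is_derive_fmul H H; rewrite [a 0 i * _]mulrC.
Qed.

Lemma is_derive_radial (h : R -> R) (h1 : R) x a :
  x != 0 -> is_derive (enorm x) 1 h h1 ->
  is_derive x a (fun y => h (enorm y)) (h1 / enorm x * dotrv x a).
Proof.
move=> x0 dh; rewrite mulrAC -mulrA.
by apply: (@is_derive_chain _ _ h); last exact: is_derive_enorm.
Qed.

(** The function differentiated is the derivative along [b] found in [is_derive_radial]. For
    coordinate vectors [a], [b] the result is an entry of [radial_hessian]; for [a = b] it is the
    quadratic form. *)
Lemma is_derive_radial2 (h1 : R -> R) (h2 : R) x a b :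
  x != 0 -> is_derive (enorm x) 1 h1 h2 ->
  is_derive x a (fun y => h1 (enorm y) / enorm y * dotrv y b)
    ((h2 - h1 (enorm x) / enorm x) / enorm x ^+ 2 * (dotrv x a * dotrv x b)
     + h1 (enorm x) / enorm x * dotrv a b).
Proof.
move=> x0 dh.
have r0 : enorm x != 0 by rewrite enorm_eq0.
have dk : is_derive (enorm x) 1 (fun r => h1 r / r)
    (h2 / enorm x + h1 (enorm x) * - enorm x ^- 2).
  apply: is_derive_fmul => //.
  apply: is_derive_eq; first exact: is_deriveV.
  by rewrite -[_ *: _]/(_ * _) mulr1.
have := is_derive_fmul (is_derive_radial a x0 dk) (is_derive_dotrv x a b).
by congr (is_derive _ _ _ _); field.
Qed.

End radial_derive.

(** * The class F *)

Lemma derivative_on_is_derive {R : realType} (f f' : R -> R) (r : R) :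
  derivative_on `[0, +oo[ f f' -> 0 < r -> is_derive r 1 f (f' r).
Proof.
move=> df r0; apply/is_deriveE; apply/cvgrPdist_lt => e e0.
have /df : `[0, +oo[%classic r by rewrite /= in_itv/= ltW.
move=> /cvgrPdist_lt/(_ e e0); rewrite !near_withinE => H.
have /(@near_line _ _ _ _ (1 : R)) : \forall s \near r,
    s != r -> `|f' r - (f s - f r) / (s - r)| < e.
  have rpos : \forall s \near r, 0 < s by exact: lt_nbhsr.
  near=> s => sr; have s0 : 0 < s by near: s.
  have : s != r -> `[0, +oo[%classic s -> `|f' r - (f s - f r) / (s - r)| < e.
    by near: s.
  by apply; rewrite //= in_itv/= ltW.
apply: filterS => h H1 h0.
have := H1; rewrite [_%:A]mulr1 addrK -[_ *: (_ - _)]/(_ * _) [_^-1 * _]mulrC.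
by apply; rewrite -subr_eq0 addrK.
Unshelve. all: by end_near. Qed.

Lemma derivative_on_mean_value {R : realType} (f f' : R -> R) (r : R) :
  derivative_on `[0, +oo[ f f' -> 0 < r ->
  exists2 c : R, 0 < c < r & f r - f 0 = f' c * r.
Proof.
move=> df r0.
have D (c : R) : 0 < c -> is_derive c 1 f (f' c)
  by exact: derivative_on_is_derive.
have C (c : R) : 0 < c -> {for c, continuous f}.
  move=> /D [dc _]; apply/differentiable_continuous/derivable1_diffP.
  exact: dc.
have [| |c cr E] := @MVT R f f' 0 r r0.
- by move=> c; rewrite in_itv/= => /andP[c0 _]; exact: D.
- apply/(continuous_within_itvP _ r0); split.
  + by move=> c; rewrite in_itv/= => /andP[c0 _]; exact: C.
  + have H : (f s - f 0) / (s - 0) @[s --> 0^'+] --> f' 0.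
      have /df /cvgrPdist_lt df0 : `[0, +oo[%classic (0 : R).
        by rewrite /= in_itv/= lexx.
      apply/cvgrPdist_lt => e e0; have := df0 e e0.
      rewrite /at_right !near_withinE; apply: filterS => s H s0.
      by apply: H; rewrite ?gt_eqF//= in_itv/= ltW.
    (* Continuity at the endpoint: the one-sided difference quotient converges, so its product with
       [s] tends to 0. *)
    have : (f s - f 0) / (s - 0) * s + f 0 @[s --> 0^'+] --> f' 0 * 0 + f 0.
      apply: cvgD; last exact: cvg_cst.
      by apply: cvgM => //; apply: cvg_at_right_filter; exact: cvg_id.
    rewrite mulr0 add0r; apply: cvg_trans; apply: near_eq_cvg.
    near=> s; have s0 : s != 0 by near: s; exact: nbhs_right_neq.
    by rewrite subr0 divfK// subrK.
  + by apply: cvg_at_left_filter; exact: C.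
- by exists c; [move: cr; rewrite in_itv|rewrite E subr0].
Unshelve. all: by end_near. Qed.

Lemma near_neq0 {R : realType} {V : normedModType R} (x : V) :
  x != 0 -> \forall y \near x, y != 0.
Proof.
move=> x0; apply/nbhs_ballP; exists `|x|; rewrite /= ?normr_gt0// => y.
rewrite -ball_normE /=; apply: contraTneq => ->.
by rewrite subr0 ltxx.
Qed.

(** For [g(x) = f(|x|)] the radial formula gives [F * r = f'^(q-2) * ((p-1) f'' r + (n-1) f')], and
    this is at least [f'^(q-1)] because [f'' > 0] and [n - 1 >= 1]. As [F] tends to 0, [f'^(q-1)] is
    small against [r]; a mean value argument integrates this to a bound on [f]. *)
Lemma class_F_decay {R : realType} (n : nat) (p q : R) (f : R -> R) (e : R) :
  (2 <= n)%N -> 1 < p -> 1 < q -> class_F n p q f -> 0 < e ->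
  exists2 d : R, 0 < d & forall r, 0 < r < d -> f r <= e * r `^ (q / (q - 1)).
Proof.
move=> n2 p1 q1 [f' [f'' [[df df' _] [f0 f'0 _] f''pos /= lim0]]] e0.
have f'pos r : 0 < r -> 0 < f' r.
  move=> r0; have [c /andP[c0 _]] := derivative_on_mean_value df' r0.
  by rewrite f'0 subr0 => ->; rewrite mulr_gt0// f''pos.
have D (r : R) : 0 < r -> is_derive r 1 f (f' r)
  by exact: derivative_on_is_derive.
have D' (r : R) : 0 < r -> is_derive r 1 f' (f'' r)
  by exact: derivative_on_is_derive.
pose g (x : 'rV[R]_n) := f (enorm x).
have Dg (x a : 'rV[R]_n) : x != 0 ->
    is_derive x a g (f' (enorm x) / enorm x * dotrv x a).
  by move=> x0; apply: is_derive_radial => //; apply: D; rewrite enorm_gt0.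
have gradE (x : 'rV[R]_n) : x != 0 ->
    gradient g x = (f' (enorm x) / enorm x) *: x.
  move=> x0; apply/rowP => i; rewrite !mxE.
  by have [_ ->] := Dg x (delta_mx 0 i) x0; rewrite dotrv_delta.
have hessE (x : 'rV[R]_n) : x != 0 ->
    hessian g x = radial_hessian (f' (enorm x)) (f'' (enorm x)) x.
  move=> x0; apply/matrixP => i j; rewrite mxE radial_hessian_entry.
  apply: derive_val.
  have r0 : 0 < enorm x by rewrite enorm_gt0.
  have := is_derive_radial2 (delta_mx 0 i) (delta_mx 0 j) x0 (D' _ r0).
  rewrite !(dotrv_delta x).
  apply: near_eq_is_derive.
  have := near_neq0 x0.
  apply: filterS => y y0; apply/esym/derive_val; exact: Dg.
have qq : 0 < q - 1 by rewrite subr_gt0.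
have opE (x : 'rV[R]_n) : x != 0 ->
    f' (enorm x) `^ (q - 1) <= opF p q (gradient g x) (hessian g x) * enorm x.
  move=> x0; have r0 : 0 < enorm x by rewrite enorm_gt0.
  have h0 := f'pos _ r0.
  rewrite gradE// hessE// opF_radial ?gt_eqF// gtr0_norm//.
  have -> : f' (enorm x) `^ (q - 1) = f' (enorm x) `^ (q - 2) * f' (enorm x).
    rewrite -[X in _ * X]powRr1 ?ltW// -powRD; last first.
      by rewrite (gt_eqF h0) implybT.
    by congr (_ `^ _); ring.
  rewrite -mulrA ler_wpM2l ?powR_ge0// mulrDl divfK ?gt_eqF//.
  have A0 : 0 <= (p - 1) * f'' (enorm x) * enorm x.
    by rewrite !mulr_ge0 ?subr_ge0 ?(ltW p1) ?(ltW r0) ?(ltW (f''pos _ r0)).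
  have n1 : 1 <= n%:R - 1 :> R by rewrite lerBrDr -[1 + 1]/(2%:R) ler_nat.
  by rewrite -[leLHS]add0r lerD// ler_peMl// ltW.
have k0 : 0 < e `^ (q - 1) by exact: powR_gt0.
have n0 : (0 < n)%N by exact: ltnW.
pose e1 : 'rV[R]_n := delta_mx 0 (Ordinal n0).
have e1n : enorm e1 = 1 by exact: enorm_delta.
(* The limit is sampled on the ray through the unit vector [e1]. The tolerance [e^(q-1)] turns into
   the factor [e] once the root of order [q - 1] is taken. *)
have [d d0 Hd] : exists2 d : R, 0 < d & forall r, 0 < r < d ->
    f' r `^ (q - 1) <= e `^ (q - 1) * r.
  have : \forall x \near (0 : 'rV[R]_n), x != 0 ->
      `|0 - opF p q (gradient g x) (hessian g x)| < e `^ (q - 1).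
    by move/cvgrPdist_lt : lim0 => /(_ _ k0); rewrite near_withinE.
  move=> /(@near_line _ _ _ _ e1)/nbhs_ballP[d /= d0 H]; exists d => //.
  move=> r /andP[r0 rd].
  have x0 : r *: e1 != 0.
    by rewrite -enorm_gt0 enormZ e1n mulr1 normr_gt0 gt_eqF.
  have er : enorm (r *: e1) = r by rewrite enormZ e1n mulr1 gtr0_norm.
  have := H r; rewrite -ball_normE /= sub0r normrN gtr0_norm// addr0.
  move=> /(_ rd x0); rewrite sub0r normrN => /(le_lt_trans (ler_norm _))/ltW.
  move=> /(ler_wpM2r (ltW r0)).
  by have := opE _ x0; rewrite er; exact: le_trans.
exists d => // r /andP[r0 rd].
have [c /andP[c0 cr]] := derivative_on_mean_value df r0.
rewrite f0 subr0 => ->.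
have -> : q / (q - 1) = 1 / (q - 1) + 1 by field; rewrite gt_eqF.
rewrite powRD; last by rewrite (gt_eqF r0) implybT.
have q0 : 0 <= 1 / (q - 1) by rewrite divr_ge0// ltW.
have K0 : 0 <= e * r `^ (1 / (q - 1)) by rewrite mulr_ge0 ?powR_ge0 ?(ltW e0).
rewrite (powRr1 (ltW r0)) mulrA ler_wpM2r ?(ltW r0)//.
have H : f' c `^ (q - 1) <= (e * r `^ (1 / (q - 1))) `^ (q - 1).
  rewrite powRM ?powR_ge0 ?(ltW e0)// -powRrM mul1r mulVf ?gt_eqF//.
  rewrite (powRr1 (ltW r0)).
  rewrite (le_trans (Hd c _)) ?c0 ?(lt_trans cr)//.
  by rewrite ler_wpM2l ?powR_ge0// (ltW cr).
have := ge0_ler_powR q0 _ _ H.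
rewrite !nnegrE !powR_ge0 => /(_ isT isT).
have V : (q - 1) * (1 / (q - 1)) = 1 by rewrite mul1r mulfV// gt_eqF.
by rewrite -!powRrM V (powRr1 (ltW (f'pos _ c0))) (powRr1 K0).
Unshelve. all: by end_near. Qed.

(** * Radial viscosity solutions *)

Lemma enorm_continuous {R : realType} (n : nat) : continuous (@enorm R n).
Proof.
move=> x; apply: (@continuous_comp _ _ _ (fun y : 'rV[R]_n => \sum_i y 0 i ^+ 2)
  Num.sqrt); last exact: sqrt_continuous.
have -> : (fun y : 'rV[R]_n => \sum_i y 0 i ^+ 2) =
    \sum_i (fun y : 'rV[R]_n => y 0 i ^+ 2).
  by apply/funext => y; rewrite fct_sumE.
elim/big_ind: _ => [|f g cf cg|i _]; first exact: cst_continuous.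
  exact: continuousD.
apply: (@continuous_comp _ _ _ (fun y : 'rV[R]_n => y 0 i) (fun r => r ^+ 2)).
  exact: coord_continuous.
exact: exprn_continuous.
Qed.

(** Handles the points where a power meets a kink: the centre, the free boundary, and the origin for
    [|r|^a]. *)
Lemma is_derive_small {R : realType} (k : R -> R) (a : R) :
  1 < a -> (forall s, `|k s| <= `|s| `^ a) -> is_derive (0 : R) 1 k 0.
Proof.
move=> a1 ka; have b0 : 0 < a - 1 by rewrite subr_gt0.
have k0 : k 0 = 0.
  apply/eqP; rewrite -normr_eq0 eq_le normr_ge0 andbT (le_trans (ka _))//.
  by rewrite normr0 powR0// gt_eqF// (lt_trans ltr01).
apply/is_deriveE/cvgrPdist_lt => e e0; apply/dnbhs_dist.
exists (e `^ (a - 1)^-1); first exact: powR_gt0.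
move=> s s0 se; rewrite sub0r normrN addr0 [_%:A]mulr1 k0 subr0 normrM normfV.
have sp : 0 < `|s| by rewrite normr_gt0.
rewrite mulrC ltr_pdivrMr// (le_lt_trans (ka _))//.
have -> : a = (a - 1) + 1 by rewrite subrK.
rewrite powRD; last by rewrite (gt_eqF sp) implybT.
rewrite (powRr1 (normr_ge0 _)) ltr_pM2r//.
have := gt0_ltr_powR b0 _ _ se.
rewrite !nnegrE normr_ge0 powR_ge0 -powRrM mulVf ?gt_eqF// (powRr1 (ltW e0)).
exact.
Qed.

(** The second alternative is the equation in radial form, as computed in [opF_radial]. The first
    one mentions no [V2], since on the free boundary of the slow profile a second derivative need
    not exist (for instance if [q > 3]). *)
Definition radial_regular {R : realType} (n : nat) (p q : R) (V : R -> R -> R)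
    (r t : R) : Prop :=
  exists (V1 : R -> R) (Vt : R),
  [/\ \forall s \near r, is_derive (s : R) 1 (V^~ t) (V1 s),
      is_derive t 1 (V r) Vt &
      (V1 r = 0 /\ Vt = 0) \/
      (V1 r != 0 /\ exists2 V2, is_derive r 1 V1 V2 &
        Vt = `|V1 r| `^ (q - 2) * ((p - 1) * V2 + (n%:R - 1) * V1 r / r))].

(** In the variable [y = r^(q/(q-1))] the profile has a nonzero slope [- b] at the tip, which
    expresses a decrease of exactly this order. The guard [0 <= r] avoids the default values of the
    power at negative bases. *)
Definition radial_center {R : realType} (q : R) (V : R -> R -> R) (t : R) :
    Prop :=
  exists (Phi : R -> R) (b Vt : R),
  [/\ 0 < b, is_derive (0 : R) 1 Phi (- b),
      \forall r \near (0 : R), 0 <= r -> V r t = Phi (r `^ (q / (q - 1))),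
      is_derive t 1 (V 0) Vt & Vt <= 0].

Lemma is_derive_lt_slope {R : realType} (Phi : R -> R) (b c : R) :
  is_derive (0 : R) 1 Phi (- b) -> c < b ->
  \forall y \near 0^'+, Phi y <= Phi 0 - c * y.
Proof.
move=> /is_deriveE dPhi cb; have e0 : 0 < b - c by rewrite subr_gt0.
move/cvgrPdist_lt : dPhi => /(_ _ e0)/dnbhs_dist[d d0 H].
near=> y; have y0 : 0 < y by near: y; exact: nbhs_right_gt.
have := H y; rewrite gt_eqF// gtr0_norm// => /(_ isT).
have yd : y < d by near: y; exact: nbhs_right_lt.
rewrite yd addr0 [_%:A]mulr1 => /(_ isT); rewrite ltr_norml => /andP[+ _].
rewrite -[_ *: _]/(_ * _) => h.
have : y^-1 * (Phi y - Phi 0) < - c by lra.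
by rewrite mulrC ltr_pdivrMr// => /ltW; rewrite mulNr lerBlDl.
Unshelve. all: by end_near. Qed.

Section radial_touching.
Context {R : realType} (n : nat) (p q : R) (V : R -> R -> R).
Hypotheses (n2 : (2 <= n)%N) (p1 : 1 < p) (q1 : 1 < q).
Let Omega := positive_times R n.
Let u (z : 'rV[R]_n * R) := V (enorm z.1) z.2.
(** [eps = 1] is touching from below, [eps = -1] from above. In both cases [eps * (u - phi)] has a
    minimum at [z], so one argument serves super- and subsolutions. *)
Variables (eps : R) (phi : 'rV[R]_n * R -> R) (z : 'rV[R]_n * R).
Hypothesis epsE : eps = 1 \/ eps = -1.
Hypothesis phi_adm : admissible p q Omega phi.
Hypothesis z_in : Omega z.
Hypothesis touch : u z = phi z.
Hypothesis touch_le : forall y, Omega y -> eps * phi y <= eps * u y.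

Let eps_neq0 : eps != 0.
Proof. by case: epsE => ->; rewrite ?oppr_eq0 oner_eq0. Qed.

Lemma open_positive_times : open Omega.
Proof.
rewrite /Omega /positive_times.
apply: (@open_comp _ _ snd [set t : R | 0 < t]); last exact: open_gt.
by move=> y _; exact: cvg_snd.
Qed.

Let phiC2 : C2_on Omega phi. Proof. exact: phi_adm.1. Qed.

Let lineE (s : R) (e : 'rV[R]_n) :
  s *: (e, 0) + z = (s *: e + z.1, z.2) :> 'rV[R]_n * R.
Proof. by congr pair; rewrite /= scaler0 add0r. Qed.

Let line_in (s : R) (e : 'rV[R]_n) : Omega (s *: (e, 0) + z).
Proof. by rewrite lineE. Qed.

(** The gap is written with [* (-1)] and [* eps] to match the functions produced by [is_derive_fadd]
    and [is_derive_fmulr]. *)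
Let line_gap (e : 'rV[R]_n) (s : R) :
  (V (enorm ((0 : R) *: e + z.1)) z.2
   + phi ((0 : R) *: (e, 0) + z) * (-1)) * eps
  <= (V (enorm (s *: e + z.1)) z.2 + phi (s *: (e, 0) + z) * (-1)) * eps.
Proof.
rewrite !scale0r !add0r -[V (enorm z.1) z.2]/(u z) touch mulrN1 subrr mul0r.
have -> : V (enorm (s *: e + z.1)) z.2 = u (s *: (e, 0) + z) by rewrite lineE.
rewrite mulrN1 mulrBl subr_ge0 ![_ * eps]mulrC.
by apply: touch_le; exact: line_in.
Qed.

Lemma touching_time (Vt : R) :
  is_derive z.2 1 (V (enorm z.1)) Vt -> time_derivative phi z = Vt.
Proof.
move=> dV.
have dphi := C2_on_time phiC2 z_in.
have dw : is_derive z.2 1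
    (fun t => (V (enorm z.1) t + phi (z.1, t) * (-1)) * eps)
    ((Vt + time_derivative phi z * (-1)) * eps).
  by apply/is_derive_fmulr/is_derive_fadd/is_derive_fmulr.
have /eqP : (Vt + time_derivative phi z * (-1)) * eps = 0.
  apply: (is_derive_local_min dw).
  have : \forall t \near z.2, 0 < t by exact: lt_nbhsr.
  apply: filterS => t t0.
  have := touch_le (y := (z.1, t)) t0; rewrite /u /= => H.
  have E : V (enorm z.1) z.2 = phi (z.1, z.2) by rewrite -surjective_pairing.
  rewrite E; move: H; rewrite !mulrN1 subrr mul0r mulrBl subr_ge0.
  by rewrite ![_ * eps]mulrC.
by rewrite mulf_eq0 (negbTE eps_neq0) orbF mulrN1 subr_eq0 => /eqP.
Qed.

(** The hypothesis differentiates the restriction of [u] to the line rather than [V] itself, so that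
    the lemma also serves at the centre, where the norm is not differentiable. *)
Lemma touching_gradient (e : 'rV[R]_n) (l : R) :
  is_derive (0 : R) 1 (fun s => V (enorm (s *: e + z.1)) z.2) l ->
  dotrv (space_gradient phi z) e = l.
Proof.
move=> dV.
have /nbhs_singleton := C2_on_line e open_positive_times phiC2 z_in.
set k := \sum_i _ => dphi.
have -> : dotrv (space_gradient phi z) e = k.
  apply: eq_bigr => i _; rewrite mulrC space_gradientE.
  by rewrite scale0r add0r.
have dw : is_derive (0 : R) 1 (fun s => (V (enorm (s *: e + z.1)) z.2
    + phi (s *: (e, 0) + z) * (-1)) * eps) ((l + k * (-1)) * eps).
  by apply/is_derive_fmulr/is_derive_fadd/is_derive_fmulr.
have /eqP : (l + k * (-1)) * eps = 0.
  apply: (is_derive_local_min dw).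
  near=> s.
  exact: line_gap.
by rewrite mulf_eq0 (negbTE eps_neq0) orbF mulrN1 subr_eq0 => /eqP.
Unshelve. all: by end_near. Qed.

(** The second-order test for the gap on the line through [z.1] along [e]. Near [z.1] the radial
    formula gives the first derivative [W1], and [is_derive_radial2] differentiates it once more at
    the point. *)
Lemma touching_hessian (V1 : R -> R) (V2 : R) (e : 'rV[R]_n) :
  z.1 != 0 ->
  (\forall s \near enorm z.1, is_derive (s : R) 1 (V^~ z.2) (V1 s)) ->
  is_derive (enorm z.1) 1 V1 V2 ->
  0 <= (e *m (eps *: (radial_hessian (V1 (enorm z.1)) V2 z.1
                      - space_hessian phi z)) *m e^T) 0 0.
Proof.
move=> x0 dV dV1.
have dphi := C2_on_line e open_positive_times phiC2 z_in.
have dphi2 := C2_on_line2 e open_positive_times phiC2 z_in.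
pose W1 (s : R) := V1 (enorm (s *: e + z.1)) / enorm (s *: e + z.1)
                   * dotrv (s *: e + z.1) e.
have dW1 : is_derive (0 : R) 1 W1
    ((e *m radial_hessian (V1 (enorm z.1)) V2 z.1 *m e^T) 0 0).
  apply: (is_derive_line (fun y => V1 (enorm y) / enorm y * dotrv y e)
            z.1 e 0 _).1.
  rewrite scale0r add0r radial_hessian_form expr2.
  exact: is_derive_radial2.
have dW : \forall s \near (0 : R), is_derive (s : R) 1
    (fun s => V (enorm (s *: e + z.1)) z.2) (W1 s).
  have dVx : \forall y \near z.1,
      is_derive (enorm y) 1 (V^~ z.2) (V1 (enorm y)).
    exact: (@enorm_continuous R n z.1 _ dV).
  have H : \forall y \near z.1,
      y != 0 /\ is_derive (enorm y) 1 (V^~ z.2) (V1 (enorm y)).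
    near=> y; split; first by near: y; exact: (near_neq0 x0).
    by near: y.
  have := near_line e H; apply: filterS => s [s0 d].
  apply: (is_derive_line (fun y => V (enorm y) z.2) z.1 e s _).1.
  exact: (@is_derive_radial _ _ (V^~ z.2)).
pose K s := \sum_i e 0 i * 'D_(axis R (Some i)) phi (s *: (e, 0) + z).
have dw : \forall s \near (0 : R), is_derive (s : R) 1
    (fun s => (V (enorm (s *: e + z.1)) z.2
               + phi (s *: (e, 0) + z) * (-1)) * eps)
    ((W1 s + K s * (-1)) * eps).
  near=> s; apply/is_derive_fmulr/is_derive_fadd.
    by near: s; exact: dW.
  by apply/is_derive_fmulr; near: s; exact: dphi.
have dw1 := is_derive_fmulr eps
  (is_derive_fadd dW1 (is_derive_fmulr (-1) dphi2)).
suff -> : (e *m (eps *: (radial_hessian (V1 (enorm z.1)) V2 z.1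
    - space_hessian phi z)) *m e^T) 0 0 =
    ((e *m radial_hessian (V1 (enorm z.1)) V2 z.1 *m e^T) 0 0
     + (e *m space_hessian phi z *m e^T) 0 0 * (-1)) * eps.
  apply: second_order_local_min dw dw1 _.
  by near=> s; exact: line_gap.
rewrite -scalemxAr -scalemxAl mulmxBr mulmxBl mxE mulrC; congr (_ * _).
by rewrite mxE [X in _ + X]mxE mulrN1.
Unshelve. all: by end_near. Qed.

Lemma touching_regular :
  z.1 != 0 -> radial_regular n p q V (enorm z.1) z.2 ->
  (space_gradient phi z <> 0 ->
     0 <= eps * (time_derivative phi z
                 - opF p q (space_gradient phi z) (space_hessian phi z))) /\
  (space_gradient phi z = 0 -> 0 <= eps * time_derivative phi z).
Proof.
move=> x0 [V1 [Vt [dV dVt H]]].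
have r0 : enorm z.1 != 0 by rewrite enorm_eq0.
have -> := touching_time dVt.
have gradE : space_gradient phi z = (V1 (enorm z.1) / enorm z.1) *: z.1.
  apply/rowP => i; rewrite [RHS]mxE -(dotrv_delta z.1 i).
  rewrite -(dotrv_delta (space_gradient phi z) i).
  apply: touching_gradient.
  apply: (is_derive_line (fun y => V (enorm y) z.2) z.1 _ 0 _).1.
  rewrite scale0r add0r; apply: (@is_derive_radial _ _ (V^~ z.2)) => //.
  exact: nbhs_singleton dV.
(* In the degenerate alternative the test function has zero gradient and zero time derivative, so
   the condition reads [0 <= eps * 0]. *)
case: H => [[V10 ->]|[V10 [V2 dV1 VtE]]].
  split=> [|_]; last by rewrite mulr0.
  by rewrite gradE V10 mul0r scale0r.
split=> [|/eqP]; last first.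
  rewrite gradE scaler_eq0 (negbTE x0) mulf_eq0 invr_eq0 (negbTE r0).
  by rewrite (negbTE V10).
(* [u] and [phi] share the gradient and [opF] is linear in the matrix, so the claim becomes
   [opF >= 0] at [eps] times the difference of the Hessians. *)
move=> _; rewrite gradE VtE -opF_radial// -opFB -opFZ.
apply: opF_form_ge0 => //; last by move=> e; exact: touching_hessian.
by rewrite scaler_eq0 (negbTE x0) mulf_eq0 invr_eq0 (negbTE r0) (negbTE V10).
Qed.

(** For [eps = -1] the sign of [Vt] suffices. For [eps = 1], on the slice of fixed time the [sigma]
    and time terms vanish, so admissibility bounds [phi] below by [Phi 0 - f r], while touching
    bounds it above by [V r]; the two orders of decay are incompatible. *)
Lemma touching_center :
  z.1 = 0 -> radial_center q V z.2 ->
  (space_gradient phi z <> 0 ->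
     0 <= eps * (time_derivative phi z
                 - opF p q (space_gradient phi z) (space_hessian phi z))) /\
  (space_gradient phi z = 0 -> 0 <= eps * time_derivative phi z).
Proof.
move=> x0 [Phi [b [Vt [b0 dPhi VPhi dVt Vt0]]]].
have qq : 0 < q - 1 by rewrite subr_gt0.
have a1 : 1 < q / (q - 1) by rewrite ltr_pdivlMr// mul1r ltrBlDr ltrDl.
have a0 : 0 < q / (q - 1) by rewrite (lt_trans ltr01).
have V0 : V 0 z.2 = Phi 0.
  by rewrite (nbhs_singleton VPhi)// powR0// gt_eqF.
have gradE : space_gradient phi z = 0.
  apply/rowP => i; rewrite [RHS]mxE -(dotrv_delta (space_gradient phi z) i).
  apply: touching_gradient.
  have : is_derive (0 : R) 1
      (Phi \o (fun s => `|s| `^ (q / (q - 1)))) (- b * 0).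
    apply: is_derive1_comp; first by rewrite /= normr0 powR0// gt_eqF.
    by apply: (is_derive_small a1) => s; rewrite ger0_norm// powR_ge0.
  rewrite mulr0; apply: near_eq_is_derive.
  have : \forall s \near (0 : R),
      0 <= `|s| -> V `|s| z.2 = Phi (`|s| `^ (q / (q - 1))).
    have nc : `|s| @[s --> (0 : R)] --> (0 : R).
      by have := @norm_continuous _ R (0 : R); rewrite /continuous_at normr0.
    exact: (nc _ VPhi).
  apply: filterS => s /(_ (normr_ge0 s)) H.
  by rewrite /= x0 addr0 enormZ enorm_delta mulr1 H.
have timeE : time_derivative phi z = Vt.
  by apply: touching_time; rewrite x0 enorm0.
split=> // _; rewrite timeE.
case: epsE => epsV; last by rewrite epsV mulN1r oppr_ge0.
exfalso.
have [_ /(_ z z_in gradE)[dl [f [sg [dl0 cyl fF sgS phif]]]]] := phi_adm.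
(* Near the centre [f] is at most [b / 4] times the critical power, while [V] falls by at least
   [b / 2] times it. *)
have b4 : 0 < b / 4 by rewrite divr_gt0.
have [d d0 fd] := class_F_decay n2 p1 q1 fF b4.
have slope : \forall y \near 0^'+, Phi y <= Phi 0 - b / 2 * y.
  by apply: is_derive_lt_slope dPhi _; rewrite ltr_pdivrMr// ltr_pMr// ltr1n.
have VPhi' : \forall r \near 0^'+, V r z.2 = Phi (r `^ (q / (q - 1))).
  rewrite /at_right near_withinE; apply: filterS VPhi => r H r0.
  by apply: H; exact: ltW.
have slope' : \forall r \near 0^'+, Phi (r `^ (q / (q - 1)))
    <= Phi 0 - b / 2 * r `^ (q / (q - 1)).
  move: slope; rewrite /at_right near_withinE => /nbhs_ballP[d2 /= d20 Hd2].
  have /cvgrPdist_lt/(_ _ d20) pc := @powR_cvg0 R _ a0.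
  near=> r; have r0 : 0 < r by near: r; exact: nbhs_right_gt.
  apply: Hd2; last exact: powR_gt0.
  by rewrite -ball_normE /=; near: r.
have : \forall r \near 0^'+, [/\ 0 < r, r < dl, r < d &
    V r z.2 <= Phi 0 - b / 2 * r `^ (q / (q - 1))].
  near=> r; have r0 : 0 < r by near: r; exact: nbhs_right_gt.
  split; first exact: r0.
  - by near: r; exact: (nbhs_right_lt dl0).
  - by near: r; exact: (nbhs_right_lt d0).
  - have -> : V r z.2 = Phi (r `^ (q / (q - 1))) by near: r.
    by near: r.
move=> /filter_ex[r [r0 rdl rd Vr]].
have n0 : (0 < n)%N by exact: ltnW.
pose x : 'rV[R]_n := r *: delta_mx 0 (Ordinal n0).
have xr : enorm x = r by rewrite enormZ enorm_delta mulr1 gtr0_norm.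
have := phif (x, z.2); rewrite /cylinder /= x0 subr0 xr subrr normr0.
move=> /(_ (conj rdl dl0)); case: sgS => _ _ [-> _] _.
rewrite mulr0 subr0 addr0 => phir.
have fr : f r <= b / 4 * r `^ (q / (q - 1)) by rewrite fd// r0.
have phi_le : phi (x, z.2) <= V r z.2.
  have := touch_le (y := (x, z.2)) z_in.
  by rewrite epsV !mul1r /u /= xr.
have phiz : phi z = Phi 0 by rewrite -touch /u x0 enorm0.
have rq : 0 < r `^ (q / (q - 1)) by exact: powR_gt0.
move: phir; rewrite ler_norml => /andP[+ _].
rewrite phiz.
have := mulr_gt0 b0 rq; move: fr phi_le Vr; set Y := _ `^ _.
lra.
Unshelve. all: by end_near. Qed.

End radial_touching.

Lemma continuous_lower_semicontinuous {R : realType} {X : topologicalType}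
    (f : X -> R) :
  continuous f -> lower_semicontinuous (fun x => (f x)%:E).
Proof.
move=> cf x a; rewrite lte_fin => afx.
exists [set y | a < f y]; last by move=> y; rewrite /= lte_fin.
exact: (cf x _ (lt_nbhsr afx)).
Qed.

Lemma radial_viscosity_solution {R : realType} (n : nat) (p q : R)
    (V : R -> R -> R) :
  (2 <= n)%N -> 1 < p -> 1 < q ->
  (forall z : 'rV[R]_n * R, 0 < z.2 ->
     {for z, continuous (fun z : 'rV[R]_n * R => V (enorm z.1) z.2)}) ->
  (forall r t, 0 < r -> 0 < t -> radial_regular n p q V r t) ->
  (forall t, 0 < t -> radial_center q V t) ->
  viscosity_solution p q (positive_times R n)
    (fun z : 'rV[R]_n * R => V (enorm z.1) z.2).
Proof.
move=> n2 p1 q1 cV regV cenV.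
set Omega := positive_times R n; set u := fun z : 'rV[R]_n * R => V _ _.
have oO : open Omega by exact: open_positive_times.
have cu : {within Omega, continuous u}.
  by rewrite continuous_open_subspace// => z; rewrite inE; exact: cV.
have dens : Omega `<=` closure (Omega `&` [set z | (u z)%:E \is a fin_num]).
  by move=> z Oz; apply: subset_closure.
have main eps phi z : eps = 1 \/ eps = -1 -> admissible p q Omega phi ->
    Omega z -> u z = phi z -> (forall y, Omega y -> eps * phi y <= eps * u y) ->
    (space_gradient phi z <> 0 ->
     0 <= eps * (time_derivative phi z
                 - opF p q (space_gradient phi z) (space_hessian phi z))) /\
    (space_gradient phi z = 0 -> 0 <= eps * time_derivative phi z).
  move=> epsE adm Oz uz le.
  have [x0|x0] := eqVneq z.1 0.
    by apply: (touching_center n2 p1 q1 epsE adm Oz uz le x0); exact: cenV.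
  apply: (touching_regular p1 epsE adm Oz uz le x0); apply: regV => //.
  by rewrite enorm_gt0.
split => //; split => //.
- exact: (continuous_lower_semicontinuous cu).
- move=> phi z adm [Oz uz lt].
  have [] := main 1 phi z; rewrite ?mul1r//; try by left.
  + by case: uz.
  + move=> y Oy; rewrite !mul1r -lee_fin.
    have [->|/eqP yz] := eqVneq y z; first by rewrite -uz.
    exact/ltW/lt.
- move=> x a.
  exact: (@continuous_lower_semicontinuous R (subspace Omega) (fun z => - u z)
    (fun x => continuousN (cu x))).
- move=> phi z adm [Oz uz lt].
  have [] := main (-1) phi z; rewrite ?mulN1r//; try by right.
  + by case: uz.
  + move=> y Oy; rewrite !mulN1r lerN2 -lee_fin.
    have [->|/eqP yz] := eqVneq y z; first by rewrite -uz.
    exact/ltW/lt.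
  + move=> h1 h2; split=> [/h1|/h2]; by rewrite oppr_ge0.
Qed.

(** * The Barenblatt profiles *)

Lemma is_derive_continuous {R : realType} (f : R -> R) (x df : R) :
  is_derive x 1 f df -> {for x, continuous f}.
Proof.
by move=> [d _]; apply/differentiable_continuous/derivable1_diffP.
Qed.

Lemma is_derive_max_powR_gt0 {R : realType} (b y : R) : 0 < y ->
  is_derive y 1 (fun x => Num.max x 0 `^ b) (b * Num.max y 0 `^ (b - 1)).
Proof.
move=> y0; rewrite (max_l (ltW y0)).
apply: (near_eq_is_derive _ (is_derive1_powR b y0)).
near=> x; have x0 : 0 < x by near: x; exact: lt_nbhsr.
by rewrite (max_l (ltW x0)).
Unshelve. all: by end_near. Qed.

(** At [y = 0] the function is bounded by [|s|^b], so its derivative is 0; the formula agrees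
    because [b - 1] is nonzero (the power [0^0] is 1). *)
Lemma is_derive_max_powR {R : realType} (b y : R) : 1 < b ->
  is_derive y 1 (fun x => Num.max x 0 `^ b) (b * Num.max y 0 `^ (b - 1)).
Proof.
move=> b1; case: (boolP (0 < y)) => [|]; first exact: is_derive_max_powR_gt0.
rewrite -leNgt le_eqVlt => /predU1P[->|y0].
  rewrite maxxx powR0 ?subr_eq0 ?gt_eqF// mulr0.
  apply: (is_derive_small b1) => s.
  rewrite ger0_norm ?powR_ge0//.
  have [s0|s0] := leP s 0; last by rewrite gtr0_norm.
  by rewrite powR0 ?powR_ge0// gt_eqF// (lt_trans ltr01).
rewrite (max_r (ltW y0)) powR0 ?subr_eq0 ?gt_eqF// mulr0.
apply: (near_eq_is_derive _ (is_derive_fcst 0 y 1)).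
near=> x; have x0 : x < 0 by near: x; exact: lt_nbhsl.
by rewrite (max_r (ltW x0)) powR0// gt_eqF// (lt_trans ltr01).
Unshelve. all: by end_near. Qed.

Lemma norm_powR_continuous {R : realType} (a : R) :
  1 < a -> continuous (fun r : R => `|r| `^ a).
Proof.
move=> a1 r; have [->|r0] := eqVneq r 0.
  apply: (@is_derive_continuous _ _ _ 0); apply: (is_derive_small a1) => s.
  by rewrite ger0_norm// powR_ge0.
apply: (@continuous_comp _ _ _ (fun r : R => `|r|) (fun r => r `^ a)).
  exact: norm_continuous.
apply: is_derive_continuous; apply: is_derive1_powR.
by rewrite normr_gt0.
Qed.

(** The radial equation with every power replaced by an atom: [Sg], [M], [X], [g] stand for
    [s^(-alpha)], [s^(-mu)], [r^(a-1)], [G^(be-1)], and [g0] for [G]. [Lam] appears as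
    [be * ka * a], so that only a rational identity remains. *)
Lemma barenblatt_equation {R : realType} (N p q : R) (d a be c0 : R)
    (l ka r s X M Sg g0 g : R) :
  p - 1 != 0 -> q - 1 != 0 -> q - 2 != 0 -> q != 0 ->
  l != 0 -> ka != 0 -> r != 0 -> s != 0 -> X != 0 -> M != 0 -> g0 != 0 ->
  d = (N - 1) * (q - 1) / (p - 1) + 1 -> a = q / (q - 1) ->
  be = (q - 1) / (q - 2) -> c0 = (p - 1) / (q - 1) ->
  - (d / l) * (Sg / s) * c0 * (g0 * g) +
  Sg * (be * g * (- ka * (r * X * (- (a / l) * (M / s) * c0)))) =
  r * g0 / (s * M * (l * (be * ka * a)) * X) *
  ((p - 1) *
   (((be - 1) * (g / g0) * (- ka * (a * X * M)) * be * (X * a * M * - ka) +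
     g * be * ((a - 1) * (X / r) * a * M * - ka)) * Sg) +
   (N - 1) * (Sg * (be * g * (- ka * (a * X * M)))) / r).
Proof.
move=> p0 q10 q20 q0 l0 ka0 r0 s0 X0 M0 g00 -> -> -> ->.
field; repeat (apply/andP; split) => //.
Qed.

(* For [q < 2] the coefficient [ka] is negative, so that the [Num.max] is not
   active and [barenblatt_slow] covers both ranges of [q]. *)
Section barenblatt.
Context {R : realType} (n : nat) (p q C : R).
Hypotheses (n2 : (2 <= n)%N) (p1 : 1 < p) (q1 : 1 < q) (q2 : q != 2)
  (C0 : 0 < C).
Let d := fict_dim n p q.
Let l := lambda q d.
Hypothesis l0 : 0 < l.
Let c0 := (p - 1) / (q - 1).
Let a := q / (q - 1).
Let alpha := d / l.
Let mu := a / l.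
Let be := (q - 1) / (q - 2).
Let Lam := l `^ (1 / (1 - q)).
Let ka := (q - 2) / q * Lam.
Let P (y : R) := Num.max y 0 `^ be.
Let P1 (y : R) := Num.max y 0 `^ (be - 1).
(** The bracket of the profile, with [(r / s^(1/l))^a] split into one power of each variable. *)
Let G (r s : R) := C - ka * (r `^ a * s `^ (- mu)).
Let V (r t : R) := barenblatt_slow q d C r (c0 * t).

Let q10 : 0 < q - 1. Proof. by rewrite subr_gt0. Qed.
Let p10 : 0 < p - 1. Proof. by rewrite subr_gt0. Qed.
Let qgt0 : 0 < q. Proof. exact: lt_trans q1. Qed.
Let q20 : q - 2 != 0. Proof. by rewrite subr_eq0. Qed.
Let c0_gt0 : 0 < c0. Proof. by rewrite divr_gt0. Qed.
Let n1 : 0 < n%:R - 1 :> R.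
Proof. by rewrite subr_gt0 ltr1n. Qed.
Let d0 : 0 < d.
Proof. by rewrite /d /fict_dim addr_gt0// divr_gt0// mulr_gt0. Qed.
Let a1 : 1 < a.
Proof. by rewrite ltr_pdivlMr// mul1r ltrBlDr ltrDl. Qed.
Let a0 : 0 < a. Proof. exact: lt_trans a1. Qed.
Let Lam0 : 0 < Lam. Proof. exact: powR_gt0. Qed.
(** The factors [q - 2] of [be] and [ka] cancel; hence the profile decreases in [r] for both ranges
    of [q]. *)
Let beka : be * ka * a = Lam.
Proof.
by rewrite /be /ka /a; field; rewrite q20 (gt_eqF q10) (gt_eqF qgt0).
Qed.

Let VE (r t : R) : 0 <= r -> 0 < t ->
  V r t = (c0 * t) `^ (- alpha) * P (G r (c0 * t)).
Proof.
move=> r0 t0; have s0 : 0 < c0 * t by rewrite mulr_gt0.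
rewrite /V /barenblatt_slow -/l -/alpha -/Lam -/ka -/be -/a /P /G.
congr (_ * Num.max (_ - _ * _) _ `^ _).
rewrite powRM ?invr_ge0 ?powR_ge0//; congr (_ * _).
by rewrite -powRN -powRrM; congr (_ `^ _); rewrite /mu; field; rewrite gt_eqF.
Qed.

(** For [q > 2] one has [be > 1] and the power is differentiable across 0; for [q < 2] it is
    negative. At [y = G r s] the disjunction always holds, by [G_gt0]. *)
Let dP (y : R) : 0 < y \/ 2 < q -> is_derive y 1 P (be * P1 y).
Proof.
case=> [y0|q2']; first exact: is_derive_max_powR_gt0.
have q20' : 0 < q - 2 by rewrite subr_gt0.
by apply: is_derive_max_powR; rewrite ltr_pdivlMr// mul1r ltrD2l ltrN2 ltr1n.
Qed.

Let G_gt0 (r s : R) : 0 < G r s \/ 2 < q.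
Proof.
have [?|q2'] := ltP 2 q; [by right|left].
rewrite subr_gt0 (le_lt_trans _ C0)// mulr_le0_ge0 ?mulr_ge0 ?powR_ge0//.
by rewrite mulr_le0_ge0 ?(ltW Lam0)// mulr_le0_ge0 ?subr_le0// invr_ge0 ltW.
Qed.

Let V1 (s r : R) :=
  s `^ (- alpha) * (be * P1 (G r s) *
    (- ka * (a * r `^ (a - 1) * s `^ (- mu)))).

Let dGr (r s : R) : 0 < r ->
  is_derive r 1 (G^~ s) (- ka * (a * r `^ (a - 1) * s `^ (- mu))).
Proof.
move=> r0.
have H := is_derive_fmulr (- ka)
  (is_derive_fmulr (s `^ (- mu)) (is_derive1_powR a r0)).
have := is_derive_fadd (is_derive_fcst C r 1) H.
rewrite add0r [_ * - ka]mulrC; congr (is_derive _ _ _ _).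
by apply/funext => x; rewrite /G mulrN [ka * _]mulrC.
Qed.

Let dVr (r t : R) : 0 < r -> 0 < t -> is_derive r 1 (V^~ t) (V1 (c0 * t) r).
Proof.
move=> r0 t0; have dG := dGr (c0 * t) r0.
have H := @is_derive1_comp _ P (G^~ (c0 * t)) r _ _ (dP (G_gt0 _ _)) dG.
have := is_derive_fmulr ((c0 * t) `^ (- alpha)) H.
rewrite [_ * (c0 * t) `^ _]mulrC -/(V1 _ _); apply: near_eq_is_derive.
near=> x; have x0 : 0 < x by near: x; exact: lt_nbhsr.
by rewrite (VE (ltW x0) t0) mulrC.
Unshelve. all: by end_near. Qed.

Let dpow (b t : R) : 0 < t ->
  is_derive t 1 (fun t => (c0 * t) `^ b) (b * (c0 * t) `^ (b - 1) * c0).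
Proof.
move=> t0; have s0 : 0 < c0 * t by rewrite mulr_gt0.
apply: (@is_derive1_comp _ (fun s => s `^ b) (fun t => c0 * t)).
  exact: is_derive1_powR.
rewrite -[X in is_derive _ _ _ X]mul1r.
have -> : (fun t => c0 * t) = (fun t => t * c0).
  by apply/funext => x; exact: mulrC.
by apply: is_derive_fmulr; exact: is_derive_id.
Qed.

Let dVt (r t : R) : 0 <= r -> 0 < t -> is_derive t 1 (V r)
  (- alpha * (c0 * t) `^ (- alpha - 1) * c0 * P (G r (c0 * t)) +
   (c0 * t) `^ (- alpha) * (be * P1 (G r (c0 * t)) *
     (- ka * (r `^ a * (- mu * (c0 * t) `^ (- mu - 1) * c0))))).
Proof.
move=> r0 t0.
have dG : is_derive t 1 (fun t => G r (c0 * t))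
    (- ka * (r `^ a * (- mu * (c0 * t) `^ (- mu - 1) * c0))).
  have := is_derive_fadd (is_derive_fcst C t 1)
    (is_derive_fmulr (- ka) (is_derive_fmulr (r `^ a) (dpow (- mu) t0))).
  rewrite add0r [_ * - ka]mulrC [_ * r `^ a]mulrC.
  congr (is_derive _ _ _ _).
  by apply/funext => x; rewrite /G mulrN [ka * _]mulrC [_ * r `^ a]mulrC.
have H := @is_derive1_comp _ P (fun t => G r (c0 * t)) t _ _
  (dP (G_gt0 _ _)) dG.
have := is_derive_fmul (dpow (- alpha) t0) H; apply: near_eq_is_derive.
near=> x; have x0 : 0 < x by near: x; exact: lt_nbhsr.
by rewrite (VE r0 x0).
Unshelve. all: by end_near. Qed.

Lemma barenblatt_center (t : R) : 0 < t -> radial_center q V t.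
Proof.
move=> t0; have s0 : 0 < c0 * t by rewrite mulr_gt0.
pose Phi (y : R) :=
  P (C - ka * (y * (c0 * t) `^ (- mu))) * (c0 * t) `^ (- alpha).
exists Phi, (be * ka * P1 C * (c0 * t) `^ (- mu) * (c0 * t) `^ (- alpha)).
eexists; split; last 1 first.
- shelve.
(* For [q < 2] both [be] and [ka] are negative, so the sign has to be read off their product. *)
- have -> : be * ka = Lam / a by rewrite -beka mulfK// gt_eqF.
  by rewrite !mulr_gt0 ?powR_gt0 ?invr_gt0// lt_max C0.
- have dy : is_derive (0 : R) 1 (fun y => C - ka * (y * (c0 * t) `^ (- mu)))
      (- ka * (c0 * t) `^ (- mu)).
    have := is_derive_fadd (is_derive_fcst C (0 : R) 1) (is_derive_fmulr (- ka)
      (is_derive_fmulr ((c0 * t) `^ (- mu)) (is_derive_id (0 : R) (1 : R)))).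
    rewrite add0r mul1r [_ * - ka]mulrC; congr (is_derive _ _ _ _).
    by apply/funext => x; rewrite mulrN [ka * _]mulrC.
  have C1 : C - ka * (0 * (c0 * t) `^ (- mu)) = C by rewrite mul0r mulr0 subr0.
  have dPC : is_derive (C - ka * (0 * (c0 * t) `^ (- mu))) 1 P (be * P1 C).
    by rewrite C1; apply: dP; left; exact: C0.
  have H := @is_derive1_comp _ P (fun y => C - ka * (y * (c0 * t) `^ (- mu)))
    0 _ _ dPC dy.
  have := is_derive_fmulr ((c0 * t) `^ (- alpha)) H.
  congr (is_derive _ _ _ _); ring.
- by near=> r => r0; rewrite (VE r0 t0) mulrC.
- exact: (dVt (lexx 0) t0).
Unshelve. 2: by end_near.
(* At the tip the bracket is constantly [C], and time enters only through the decreasing factor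
   [s^(-alpha)]. *)
have -> : G 0 (c0 * t) = C by rewrite /G powR0 ?gt_eqF// mul0r mulr0 subr0.
rewrite powR0 ?gt_eqF// mul0r !mulr0 addr0 !mulNr oppr_le0.
have al0 : 0 <= alpha by rewrite divr_ge0// ltW.
have PC0 : 0 <= P C by exact: powR_ge0.
exact: (mulr_ge0 (mulr_ge0 (mulr_ge0 al0 (powR_ge0 _ _)) (ltW c0_gt0)) PC0).
Qed.

Lemma barenblatt_regular (r t : R) :
  0 < r -> 0 < t -> radial_regular n p q V r t.
Proof.
move=> r0 t0; have s0 : 0 < c0 * t by rewrite mulr_gt0.
exists (V1 (c0 * t)); eexists; split.
- near=> x; apply: dVr => //; near: x; exact: lt_nbhsr.
- exact: (dVt (ltW r0) t0).
(* Outside the open support both powers of [Num.max] vanish, their exponents being nonzero; this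
   includes the free boundary. *)
have [G0|G0] := leP (G r (c0 * t)) 0.
  have q2' : 2 < q by case: (G_gt0 r (c0 * t)) => //; rewrite ltNge G0.
  have b1 : be - 1 != 0.
    have -> : be - 1 = (q - 2)^-1 by rewrite /be; field.
    by rewrite invr_eq0.
  have b0 : be != 0 by rewrite mulf_neq0 ?invr_eq0// gt_eqF.
  by left; rewrite /V1 /P /P1 max_r// !powR0// !(mulr0, mul0r) addr0.
right; set s := c0 * t in s0 G0 *; set g0 := G r s in G0 *.
have dP1 : is_derive g0 1 P1 _ := is_derive_max_powR_gt0 (be - 1) G0.
have dPG := @is_derive1_comp _ P1 (G^~ s) r _ _ dP1 (dGr s r0).
have dX := is_derive_fmulr (s `^ (- mu))
  (is_derive_fmulr a (is_derive1_powR (a - 1) r0)).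
have dV1 := is_derive_fmulr (s `^ (- alpha)) (is_derive_fmul
  (is_derive_fmulr be dPG) (is_derive_fmulr (- ka) dX)).
have V1E : (fun y => (P1 \o G^~ s) y * be *
    (y `^ (a - 1) * a * s `^ (- mu) * - ka) * s `^ (- alpha)) = V1 s.
  by apply/funext => y; rewrite /V1 /=; ring.
rewrite V1E in dV1.
have pm (x b : R) : 0 < x -> x `^ (b - 1) = x `^ b / x.
  move=> x0; rewrite powRD; last by rewrite (gt_eqF x0) implybT.
  by rewrite powR_inv1// ltW.
have pn0 (x b : R) : 0 < x -> x `^ b != 0.
  by move=> x0; rewrite gt_eqF// powR_gt0.
have pp (x b : R) : 0 < x -> x `^ b = x * x `^ (b - 1).
  by move=> x0; rewrite pm// mulrC divfK// gt_eqF.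
have powD (x b c : R) : 0 < x -> x `^ b * x `^ c = x `^ (b + c).
  by move=> x0; rewrite powRD// (gt_eqF x0) implybT.
have lE : l = d * (q - 2) + q by [].
pose Sg := s `^ (- alpha). pose M := s `^ (- mu). pose X := r `^ (a - 1).
pose g := g0 `^ (be - 1).
have normE : `|V1 s r| = Sg * M * (Lam * (X * g)).
  have -> : V1 s r = - (Sg * M * (be * ka * a * (X * g))).
    by rewrite /V1 -/g0 /P1 (max_l (ltW G0)) -/Sg -/M -/X -/g; ring.
  by rewrite beka normrN ger0_norm// !mulr_ge0 ?powR_ge0// ltW.
have pr1 (x : R) : 0 < x -> x `^ 1 = x by move=> x0; exact/powRr1/ltW.
(* The exponents of the profile are such that the power [q - 2] of each factor of [|V1|] is rational
   in the atoms: [l = d (q - 2) + q] gives F1, [Lam^(q-1) = 1 / l] gives F2, [X^(q-1) = r] gives F3,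
   and [(be - 1)(q - 2) = 1] gives F4. *)
have F1 : (Sg * M) `^ (q - 2) = (s * M)^-1.
  have -> : s * M = s `^ (1 - mu) by rewrite -powD// pr1.
  rewrite /Sg /M powD// -powRN -powRrM.
  congr (_ `^ _); rewrite /alpha /mu /a lE; field.
  by rewrite -lE !gt_eqF.
have F2 : Lam `^ (q - 2) = (l * Lam)^-1.
  have -> : l * Lam = l `^ (1 + 1 / (1 - q)) by rewrite -powD// pr1.
  rewrite -powRN -powRrM.
  congr (_ `^ _); field; by rewrite -opprB oppr_eq0 gt_eqF.
have F3 : X `^ (q - 2) = r / X.
  have -> : r / X = r `^ (1 - (a - 1)) by rewrite -powD// pr1// powRN.
  rewrite /X -powRrM.
  congr (_ `^ _); rewrite /a; field; by rewrite gt_eqF.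
have F4 : g `^ (q - 2) = g0.
  rewrite /g -powRrM -[RHS]pr1//.
  by congr (_ `^ _); rewrite /be; field.
have normP : `|V1 s r| `^ (q - 2) = r * g0 / (s * M * (l * Lam) * X).
  have pM (x1 x2 x3 x4 k : R) : 0 <= x1 -> 0 <= x2 -> 0 <= x3 -> 0 <= x4 ->
      (x1 * (x2 * (x3 * x4))) `^ k = x1 `^ k * (x2 `^ k * (x3 `^ k * x4 `^ k)).
    by move=> *; rewrite !powRM// ?mulr_ge0.
  rewrite normE pM ?F1 ?F2 ?F3 ?F4 ?(ltW Lam0) ?powR_ge0//; last first.
    by rewrite mulr_ge0 ?powR_ge0.
  by move: (s) (M) (l) (Lam) (r) (X) (g0) => *; rewrite !invfM; ring.
split.
  rewrite -normr_eq0 normE gt_eqF// !mulr_gt0 ?powR_gt0//.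
eexists; first exact: dV1.
rewrite normP /V1 /P /P1 -/g0 (max_l (ltW G0)).
have -> : ((fun y : R => Num.max y 0 `^ (be - 1)) \o G^~ s) r = g.
  by rewrite /= -/g0 (max_l (ltW G0)).
rewrite (pm s (- alpha))// (pm s (- mu))// (pm r (a - 1))// (pm g0 (be - 1))//.
rewrite (pp r a)// (pp g0 be)// -beka.
have ka0 : ka != 0.
  by rewrite !mulf_neq0 ?invr_eq0 ?(gt_eqF qgt0) ?(gt_eqF Lam0).
exact: barenblatt_equation (lt0r_neq0 p10) (lt0r_neq0 q10) q20
  (lt0r_neq0 qgt0) (lt0r_neq0 l0) ka0 (lt0r_neq0 r0) (lt0r_neq0 s0)
  (pn0 _ _ r0) (pn0 _ _ s0) (lt0r_neq0 G0) erefl erefl erefl erefl.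
Unshelve. all: by end_near. Qed.

Lemma barenblatt_continuous (z : 'rV[R]_n * R) : 0 < z.2 ->
  {for z, continuous (fun z : 'rV[R]_n * R => V (enorm z.1) z.2)}.
Proof.
move=> t0; have s0 : 0 < c0 * z.2 by rewrite mulr_gt0.
have cs (b : R) : (c0 * y.2) `^ b @[y --> z] --> (c0 * z.2) `^ b.
  apply: (@continuous_cvg _ _ _ _ _ _ (fun s => s `^ b)).
    exact: is_derive_continuous (is_derive1_powR b s0).
  by apply: cvgM; [exact: cvg_cst|exact: cvg_snd].
(* The absolute value changes nothing on norms, but makes the power continuous at 0 from both
   sides. *)
have cr : `|enorm y.1| `^ a @[y --> z] --> `|enorm z.1| `^ a.
  apply: (@continuous_cvg _ _ _ _ _ _ (fun r : R => `|r| `^ a)).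
    exact: norm_powR_continuous.
  by apply: (@continuous_cvg _ _ _ _ _ _ (@enorm R n));
    [exact: enorm_continuous|exact: cvg_fst].
have cG : C - ka * (`|enorm y.1| `^ a * (c0 * y.2) `^ (- mu)) @[y --> z]
    --> G (enorm z.1) (c0 * z.2).
  rewrite /G -[X in _ * (X `^ _ * _)](ger0_norm (enorm_ge0 z.1)).
  apply: cvgB; first exact: cvg_cst.
  by apply: cvgM; [exact: cvg_cst|exact: cvgM].
rewrite /prop_for /continuous_at VE ?enorm_ge0//.
have cP : P (C - ka * (`|enorm y.1| `^ a * (c0 * y.2) `^ (- mu))) @[y --> z]
    --> P (G (enorm z.1) (c0 * z.2)).
  apply: (@continuous_cvg _ _ _ _ _ _ P) => //.
  exact: is_derive_continuous (dP (G_gt0 _ _)).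
apply: cvg_trans (cvgM (cs (- alpha)) cP); apply: near_eq_cvg.
have : \forall y \near z, 0 < y.2.
  exact: (@cvg_snd _ _ (nbhs z.1) (nbhs z.2) _ [set t | 0 < t] (lt_nbhsr t0)).
apply: filterS => y y0; apply: esym.
apply: etrans (VE (enorm_ge0 y.1) y0) _.
by rewrite /G -[X in _ * (X `^ _ * _)](ger0_norm (enorm_ge0 y.1)).
Qed.

Lemma barenblatt_viscosity :
  viscosity_solution p q (positive_times R n)
    (fun z => barenblatt_slow q d C (enorm z.1) (c0 * z.2)).
Proof.
exact: (radial_viscosity_solution n2 p1 q1 barenblatt_continuous
  barenblatt_regular barenblatt_center).
Qed.

End barenblatt.

(** * The heat kernel *)

Section heat_kernel.
Context {R : realType} (n : nat) (p C : R).
Hypotheses (n2 : (2 <= n)%N) (p1 : 1 < p) (C0 : 0 < C).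
Let d := fict_dim n p 2.
Let k := 4 * (p - 1).
Let V (r t : R) := heat_kernel p d C r t.

Let p10 : p - 1 != 0. Proof. by rewrite gt_eqF// subr_gt0. Qed.
Let k0 : 0 < k. Proof. by rewrite mulr_gt0// subr_gt0. Qed.
Let d0 : 0 < d.
Proof.
rewrite addr_gt0// divr_gt0 ?subr_gt0// mulr_gt0 ?subr_gt0 ?ltr1n//.
Qed.

Let VE (r t : R) :
  V r t = expR (r * r * (- (k * t)^-1)) * (C * t `^ (- (d / 2))).
Proof. by rewrite /V /heat_kernel mulrC expr2 mulrN. Qed.

Let dVr (r t : R) :
  is_derive r 1 (V^~ t) (- (2 * r / (k * t)) * V r t).
Proof.
have dr := is_derive_fmulr (- (k * t)^-1)
  (is_derive_fmul (is_derive_id r (1 : R)) (is_derive_id r (1 : R))).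
have H := is_derive_fmulr (C * t `^ (- (d / 2)))
  (@is_derive1_comp _ expR (fun r => r * r * (- (k * t)^-1)) r _ _
    (is_derive_expR _) dr).
have -> : V^~ t =
    fun x => expR (x * x * (- (k * t)^-1)) * (C * t `^ (- (d / 2))).
  by apply/funext => x; rewrite VE.
by move: H; congr (is_derive _ _ _ _); rewrite VE; ring.
Qed.

Let dVt (r t : R) : 0 < t ->
  is_derive t 1 (V r) ((r * r / (k * t * t) - d / 2 / t) * V r t).
Proof.
move=> t0; have tn0 : t != 0 by rewrite gt_eqF.
have dt : is_derive t 1 (fun t => r * r * (- (k * t)^-1)) (r * r / (k * t * t)).
  have := is_derive_fmulr (- (r * r / k))
    (is_deriveV tn0 (is_derive_id t (1 : R))).
  rewrite -[_ *: (1 : R)]/(_ * 1).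
  have -> : (- t ^- 2 * 1) * - (r * r / k) = r * r / (k * t * t).
    by field; rewrite tn0 gt_eqF.
  congr (is_derive _ _ _ _); apply/funext => x.
  by rewrite /= (invfM k x); ring.
have H := is_derive_fmul
  (@is_derive1_comp _ expR (fun t => r * r * (- (k * t)^-1)) t _ _
    (is_derive_expR _) dt)
  (is_derive_fmulr C (is_derive1_powR (- (d / 2)) t0)).
have -> : V r =
    fun t => expR (r * r * (- (k * t)^-1)) * (t `^ (- (d / 2)) * C).
  by apply/funext => x; rewrite VE [C * _]mulrC.
move: H; congr (is_derive _ _ _ _) => /=.
rewrite powRD; last by rewrite tn0 implybT.
rewrite powR_inv1 ?(ltW t0)//; ring.
Qed.

Lemma heat_kernel_regular (r t : R) :
  0 < r -> 0 < t -> radial_regular n p 2 V r t.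
Proof.
move=> r0 t0; have tn0 : t != 0 by rewrite gt_eqF.
have V0 : 0 < V r t by rewrite VE mulr_gt0 ?expR_gt0// mulr_gt0// powR_gt0.
exists (fun r => - (2 * r / (k * t)) * V r t); eexists; split.
- by near=> x; exact: dVr.
- exact: dVt.
right; split.
  by rewrite mulNr oppr_eq0 gt_eqF// mulr_gt0// divr_gt0// mulr_gt0.
have dr := is_derive_fmulr (- (2 / (k * t))) (is_derive_id r (1 : R)).
have := is_derive_fmul dr (dVr r t).
set dd := _ + _ => H.
exists dd.
  by move: H; congr (is_derive _ _ _ _); apply/funext => x; congr (_ * _); ring.
(* With [q = 2] the gradient factor is 1, and every term is a rational multiple of [V r t]. *)
rewrite subrr powRr0 mul1r /dd /d /fict_dim /k.
field; rewrite p10 tn0 gt_eqF//.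
Unshelve. all: by end_near. Qed.

(** For [q = 2] the critical exponent is 2, so [Phi] is an exponential in [y = r^2]. *)
Lemma heat_kernel_center (t : R) : 0 < t -> radial_center 2 V t.
Proof.
move=> t0; have tn0 : t != 0 by rewrite gt_eqF.
pose D := C * t `^ (- (d / 2)).
have D0 : 0 < D by rewrite mulr_gt0// powR_gt0.
exists (fun y => expR (y * (- (k * t)^-1)) * D), ((k * t)^-1 * D).
eexists; split.
- by rewrite mulr_gt0// invr_gt0 mulr_gt0.
- have dy := is_derive_fmulr (- (k * t)^-1) (is_derive_id (0 : R) (1 : R)).
  have := is_derive_fmulr D (@is_derive1_comp _ expR
    (fun y => y * (- (k * t)^-1)) 0 _ _ (is_derive_expR _) dy).
  by congr (is_derive _ _ _ _); rewrite mul0r expR0; ring.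
- near=> r => r0.
  have -> : 2 / (2 - 1) = 2%:R :> R by field.
  by rewrite powR_mulrn// VE expr2.
- exact: dVt.
- rewrite mulr0 mul0r sub0r mulNr oppr_le0.
  by rewrite VE !mulr_ge0 ?expR_ge0 ?powR_ge0 ?invr_ge0 ?ltW.
Unshelve. all: by end_near. Qed.

Lemma heat_kernel_continuous (z : 'rV[R]_n * R) : 0 < z.2 ->
  {for z, continuous (fun z : 'rV[R]_n * R => V (enorm z.1) z.2)}.
Proof.
move=> t0.
have ct : y.2 `^ (- (d / 2)) @[y --> z] --> z.2 `^ (- (d / 2)).
  apply: (@continuous_cvg _ _ _ _ _ _ (fun s => s `^ (- (d / 2)))).
    exact: is_derive_continuous (is_derive1_powR _ t0).
  exact: cvg_snd.
have cr : enorm y.1 @[y --> z] --> enorm z.1.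
  by apply: (@continuous_cvg _ _ _ _ _ _ (@enorm R n));
    [exact: enorm_continuous|exact: cvg_fst].
have ck : - (k * y.2)^-1 @[y --> z] --> - (k * z.2)^-1.
  apply: cvgN; apply: cvgV; first by rewrite gt_eqF// mulr_gt0.
  by apply: cvgM; [exact: cvg_cst|exact: cvg_snd].
rewrite /prop_for /continuous_at VE.
have -> : (fun y : 'rV[R]_n * R => V (enorm y.1) y.2) =
    fun y => expR (enorm y.1 * enorm y.1 * (- (k * y.2)^-1)) *
             (C * y.2 `^ (- (d / 2))).
  by apply/funext => y; rewrite VE.
apply: cvgM; last by apply: cvgM => //; exact: cvg_cst.
apply: (@continuous_cvg _ _ _ _ _ _ (@expR R)); first exact: continuous_expR.
by apply: cvgM => //; exact: cvgM.
Qed.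

Lemma heat_kernel_viscosity :
  viscosity_solution p 2 (positive_times R n)
    (fun z => heat_kernel p d C (enorm z.1) z.2).
Proof.
exact: (radial_viscosity_solution n2 p1 (ltr1n _ 2) heat_kernel_continuous
  heat_kernel_regular heat_kernel_center).
Qed.

End heat_kernel.

(** * The fast range and the assembly of the three cases *)

Lemma barenblatt_fastE {R : realType} (q d C r s : R) :
  1 < q < 2 -> 0 < C -> barenblatt_fast q d C r s = barenblatt_slow q d C r s.
Proof.
move=> /andP[q1 q2] C0; rewrite /barenblatt_fast /barenblatt_slow.
set l := lambda q d; set X := _ `^ (q / (q - 1)).
have E : C + (2 - q) / q * l `^ (1 / (1 - q)) * X =
         C - (q - 2) / q * l `^ (1 / (1 - q)) * X by ring.
have q0 : 0 < q by exact: lt_trans q1.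
have G0 : 0 <= C + (2 - q) / q * l `^ (1 / (1 - q)) * X.
  rewrite addr_ge0 ?(ltW C0)// !mulr_ge0 ?powR_ge0 ?invr_ge0 ?(ltW q0)//.
  by rewrite subr_ge0 ltW.
rewrite -E (max_l G0); congr (_ * _ `^ _).
by field; rewrite -opprB oppr_eq0 subr_eq0 gt_eqF.
Qed.

(* [lambda = (q - 1) ((n - 1) (q - 2) / (p - 1) + 2)], so the range condition
   says exactly that [lambda] is positive. *)
Lemma lambda_gt0 {R : realType} (n : nat) (p q : R) :
  (2 <= n)%N -> 1 < p -> 1 < q ->
  (p < (1 + n%:R) / 2 -> 2 * (n%:R - p) / (n%:R - 1) < q) ->
  0 < lambda q (fict_dim n p q).
Proof.
move=> n2 p1 q1 range.
have p10 : 0 < p - 1 by rewrite subr_gt0.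
have n1 : 0 < n%:R - 1 :> R by rewrite subr_gt0 ltr1n.
have H : 2 * (n%:R - p) < q * (n%:R - 1).
  rewrite -ltr_pdivrMr//.
  have [/range //|pn] := ltP p ((1 + n%:R) / 2).
  rewrite (le_lt_trans _ q1)// ler_pdivrMr//; lra.
have -> : lambda q (fict_dim n p q) =
    (q - 1) * ((n%:R - 1) * (q - 2) + 2 * (p - 1)) / (p - 1).
  by rewrite /lambda /fict_dim; field; rewrite gt_eqF.
rewrite divr_gt0// mulr_gt0 ?subr_gt0//; lra.
Qed.

Unset Implicit Arguments.

Theorem proposition4p4 (R : realType) (n : nat) (p q C : R)
    (hn : (2 <= n)%N) (hp : 1 < p) (hq : 1 < q) (hC : 0 < C) :
  let d := fict_dim n p q in
  let Omega := positive_times R n in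
  [/\ 2 < q ->
      viscosity_solution p q Omega
        (fun z => barenblatt_slow q d C (enorm z.1) ((p - 1) / (q - 1) * z.2)),
      q < 2 ->
      ((1 + n%:R) / 2 <= p -> 1 < q) /\
      (p < (1 + n%:R) / 2 -> 2 * (n%:R - p) / (n%:R - 1) < q) ->
      viscosity_solution p q Omega
        (fun z => barenblatt_fast q d C (enorm z.1) ((p - 1) / (q - 1) * z.2)) &
      q = 2 ->
      viscosity_solution p q Omega
        (fun z => heat_kernel p d C (enorm z.1) z.2)].
Proof.
move=> d Omega; split.
- move=> q2; apply: barenblatt_viscosity => //; first by rewrite gt_eqF.
  (* For [q > 2] the range condition is automatic: [2 (n - p) / (n - 1) < 2] because [p > 1]. *)
  apply: lambda_gt0 => // _; apply: lt_trans q2.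
  rewrite ltr_pdivrMr ?subr_gt0 ?ltr1n//; lra.
- move=> q2 [_ range].
  rewrite (_ : (fun z => _) = fun z : 'rV[R]_n * R =>
    barenblatt_slow q d C (enorm z.1) ((p - 1) / (q - 1) * z.2)).
    apply: barenblatt_viscosity => //; first by rewrite lt_eqF.
    exact: lambda_gt0.
  by apply/funext => z; rewrite barenblatt_fastE ?hq.
- by move=> q2; rewrite /d q2; exact: heat_kernel_viscosity.
Qed.
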